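(* Let $k$ be an algebraically closed field, let $m\ge 1$, and let $f=\sum_{i+j+l=2m}a_{i,j,l}\,x_0^ix_1^jx_2^l\in k[x_0,x_1,x_2]$ be an irreducible homogeneous polynomial of even degree $d=2m$, defining the irreducible plane curve $C=\mathcal Z(f)\subset\mathbb P^2$. Let $\sigma:\mathbb P^2\to\mathbb P^5$ be the Veronese embedding, let $S=k[x_{00},x_{01},x_{02},x_{11},x_{12},x_{22}]$, and let $\mathcal I_C\subset S$ be the homogeneous ideal of $\sigma(C)$. Let $F\in S$ (homogeneous of degree $m$) and the matrices $M_1,M_2,M_3$ be as defined in the context. Then $S/\mathcal I_C$ has the graded free resolution (i.e. the following sequence of graded $S$-modules and degree-$0$ maps is exact) $$0\to S(-m-4)^{\oplus 3}\xrightarrow{M'_4} S(-4)^{\oplus 3}\oplus S(-m-3)^{\oplus 8}\xrightarrow{M'_3} S(-3)^{\oplus 8}\oplus S(-m-2)^{\oplus 6}\xrightarrow{M'_2} S(-2)^{\oplus 6}\oplus S(-m)\xrightarrow{M'_1} S\to S/\mathcal I_C\to 0,$$ where the maps are given, acting on column vectors, by the block matrices $$M'_1=\begin{bmatrix} M_1 & F\end{bmatrix},\qquad M'_2=\begin{bmatrix} M_2 & -F\,I_6\\ 0 & M_1\end{bmatrix},\qquad M'_3=\begin{bmatrix} M_3 & F\,I_8\\ 0 & M_2\end{bmatrix},\qquad M'_4=\begin{bmatrix} -F\,I_3\\ M_3\end{bmatrix},$$ with $I_n$ the $n\times n$ identity matrix.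
   Context: $S=k[x_{00},x_{01},x_{02},x_{11},x_{12},x_{22}]$ with standard grading; $S(e)$ is the graded module with $S(e)_n=S_{e+n}$. The Veronese embedding is $\sigma(a_0,a_1,a_2)=(a_0^2,a_0a_1,a_0a_2,a_1^2,a_1a_2,a_2^2)$, where $x_{00},x_{01},x_{02},x_{11},x_{12},x_{22}$ are the corresponding homogeneous coordinates on $\mathbb P^5$. The homogeneous ideal $\mathcal I_C$ of $\sigma(C)$ is the ideal generated by all homogeneous elements of $S$ vanishing on $\sigma(C)$. The polynomial $F$: given $f=\sum_{i+j+l=2m}a_{i,j,l}x_0^ix_1^jx_2^l$, put $$F=\sum_{i,j,l\text{ even}}a_{i,j,l}\,x_{00}^{i/2}x_{11}^{j/2}x_{22}^{l/2}+\sum_{i\text{ even},\ j,l\text{ odd}}a_{i,j,l}\,x_{00}^{i/2}x_{11}^{(j-1)/2}x_{22}^{(l-1)/2}x_{12}$$ $$+\sum_{j\text{ even},\ i,l\text{ odd}}a_{i,j,l}\,x_{00}^{(i-1)/2}x_{11}^{j/2}x_{22}^{(l-1)/2}x_{02}+\sum_{l\text{ even},\ i,j\text{ odd}}a_{i,j,l}\,x_{00}^{(i-1)/2}x_{11}^{(j-1)/2}x_{22}^{l/2}x_{01},$$ all sums being over $i+j+l=2m$ with $i,j,l\ge0$. (It maps to $f$ under the $k$-algebra map $x_{ij}\mapsto x_ix_j$.) The matrices: $M_1=[\Delta_{00},\Delta_{01},\Delta_{02},\Delta_{11},\Delta_{12},\Delta_{22}]$ with $\Delta_{00}=x_{11}x_{22}-x_{12}^2$,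 $\Delta_{01}=x_{01}x_{22}-x_{12}x_{02}$, $\Delta_{02}=x_{01}x_{12}-x_{02}x_{11}$, $\Delta_{11}=x_{00}x_{22}-x_{02}^2$, $\Delta_{12}=x_{00}x_{12}-x_{02}x_{01}$, $\Delta_{22}=x_{00}x_{11}-x_{01}^2$; $$M_2=\begin{bmatrix} x_{02}&0&x_{01}&0&0&x_{00}&0&0\\ -x_{12}&x_{02}&-x_{11}&x_{01}&0&0&x_{00}&0\\ x_{22}&0&x_{12}&x_{02}&x_{01}&x_{02}&0&x_{00}\\ 0&-x_{12}&0&-x_{11}&0&-x_{11}&-x_{01}&0\\ 0&x_{22}&0&0&-x_{11}&x_{12}&x_{02}&-x_{01}\\ 0&0&0&x_{22}&x_{12}&0&0&x_{02} \end{bmatrix},\qquad M_3=\begin{bmatrix} x_{01}&x_{00}&0\\ -x_{11}&-x_{01}&0\\ -x_{02}&0&x_{00}\\ x_{12}&x_{02}&0\\ -x_{22}&0&x_{02}\\ 0&-x_{02}&-x_{01}\\ 0&x_{12}&x_{11}\\ 0&-x_{22}&-x_{12} \end{bmatrix}.$$ *)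

(* Defs.v *)
From HB Require Import structures.
From mathcomp Require Import all_boot all_order all_algebra.
From mathcomp Require Import ring_quotient boolp mpoly.

Set Implicit Arguments.
Unset Strict Implicit.
Unset Printing Implicit Defensive.

Import GRing.Theory.
Local Open Scope ring_scope.
Local Open Scope quotient_scope.

Definition irreducible_elt (R : idomainType) (p : R) : Prop :=
  [/\ p != 0, p \isn't a GRing.unit &
      forall q r : R, p = q * r -> q \is a GRing.unit \/ r \is a GRing.unit].

Section GradedModules.
Context (k : fieldType) (n : nat).
Local Notation S := {mpoly k[n]}.

(* S_d for the standard grading, with S_d = 0 for d < 0 *)
Definition mpoly_piece (d : int) (p : S) : Prop :=
  if d is Posz j then p \is j.-homog else p = 0.

Record gradedModType := GradedModType {
  grmod_sort :> lmodType S;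
  piece : int -> grmod_sort -> Prop;
  piece0 : forall d, piece d 0;
  pieceB : forall d x y, piece d x -> piece d y -> piece d (x - y);
  pieceZ : forall d e a x, mpoly_piece d a -> piece e x -> piece (d + e) (a *: x);
  piece_span : forall x, exists2 s : seq grmod_sort,
    forall y, y \in s -> exists d, piece d y & x = \sum_(y <- s) y;
  piece_free : forall (s : seq int) (y : int -> grmod_sort),
    uniq s -> (forall d, piece d (y d)) -> \sum_(d <- s) y d = 0 ->
    forall d, d \in s -> y d = 0
}.

Definition graded_hom (M N : gradedModType) (f : M -> N) : Prop :=
  linear f /\ forall d x, piece d x -> piece d (f x).

Definition exact_at (L M N : gradedModType) (f : L -> M) (g : M -> N) : Prop :=
  forall y, g y = 0 <-> exists x, f x = y.

Definition mpoly_comp (d : int) (p : S) : S :=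
  if d is Posz j then pihomog mdeg j p else 0.

Lemma mpoly_comp_is_additive d : zmod_morphism (mpoly_comp d).
Proof. by case: d => j p q /=; rewrite ?subr0 // raddfB. Qed.

HB.instance Definition _ d :=
  GRing.isZmodMorphism.Build S S (mpoly_comp d) (mpoly_comp_is_additive d).

Lemma mpoly_comp_id d p : mpoly_piece d p -> mpoly_comp d p = p.
Proof. by case: d => j /=; [exact: pihomog_dE | move->]. Qed.

Lemma mpoly_comp_ne d e p : d != e -> mpoly_piece d p -> mpoly_comp e p = 0.
Proof.
case: d => j; case: e => i //= ne hp; last by rewrite hp raddf0.
by apply: (pihomog_ne0 _ hp).
Qed.

Lemma mpoly_piece0 d : mpoly_piece d 0.
Proof. by case: d => j //=; exact: dhomog0. Qed.

Lemma mpoly_pieceB d p q :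
  mpoly_piece d p -> mpoly_piece d q -> mpoly_piece d (p - q).
Proof. by case: d => j /=; [exact: rpredB | move=> -> ->; rewrite subr0]. Qed.

Lemma mpoly_pieceM d e p q :
  mpoly_piece d p -> mpoly_piece e q -> mpoly_piece (d + e) (p * q).
Proof.
case: d => [i hp|i ->]; last by rewrite mul0r => _; exact: mpoly_piece0.
case: e => [j hq|j ->]; last by rewrite mulr0; exact: mpoly_piece0.
exact: dhomogM.
Qed.

Lemma mpoly_piece_free (s : seq int) (y : int -> S) (e : int) :
  uniq s -> (forall d, mpoly_piece (e + d) (y d)) ->
  forall d, d \in s -> mpoly_comp (e + d) (\sum_(d <- s) y d) = y d.
Proof.
move=> us hy d ds; rewrite raddf_sum (bigD1_seq d) //= mpoly_comp_id //.
rewrite big1 ?addr0 // => d' ne; apply: mpoly_comp_ne (hy d').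
by apply: contra ne => /eqP /addrI ->.
Qed.

(* For e = (e_1, ..., e_r), the module S(e_1) (+) ... (+) S(e_r), whose        *)
(* elements are written as column vectors.                                     *)
Section Free.
Context (r : nat) (e : 'cV[int]_r).

Definition free_piece (d : int) (v : 'cV[S]_r) : Prop :=
  forall i, mpoly_piece (e i 0 + d) (v i 0).

Lemma free_piece0 d : free_piece d 0.
Proof. by move=> i; rewrite mxE; exact: mpoly_piece0. Qed.

Lemma free_pieceB d u v :
  free_piece d u -> free_piece d v -> free_piece d (u - v).
Proof. by move=> hu hv i; rewrite !mxE; exact: mpoly_pieceB. Qed.

Lemma free_pieceZ d d' a v :
  mpoly_piece d a -> free_piece d' v -> free_piece (d + d') (a *: v).
Proof. by move=> ha hv i; rewrite mxE addrCA; exact: mpoly_pieceM. Qed.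

Lemma free_piece_span (v : 'cV[S]_r) : exists2 s : seq 'cV[S]_r,
  forall y, y \in s -> exists d, free_piece d y & v = \sum_(y <- s) y.
Proof.
pose N := (\max_(i < r) msize (v i 0%R))%N.
pose w (t : 'I_r * 'I_N) : 'cV[S]_r :=
  \col_i (if i == t.1 then pihomog mdeg t.2 (v i 0) else 0).
exists [seq w t | t <- enum {: 'I_r * 'I_N}].
  move=> y /mapP [[i j] _ ->]; exists (Posz j - e i 0) => i'; rewrite mxE /=.
  case: eqP => [->|_]; last exact: mpoly_piece0.
  by rewrite addrCA subrr addr0 /=; exact: pihomogP.
rewrite big_map big_enum /= -(pair_bigA _ (fun i j => w (i, j))) /=.
apply/colP => i'; rewrite summxE (bigD1 i') //= [X in _ + X]big1 => [|i ne].
  rewrite addr0 summxE [LHS](@pihomog_partitionE _ _ mdeg N) /N //.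
    by apply: eq_bigr => j _; rewrite mxE eqxx.
  exact: (leq_bigmax (F := fun i => msize (v i 0)) i').
by rewrite summxE big1 // => j _; rewrite mxE eq_sym (negPf ne).
Qed.

Lemma free_piece_free (s : seq int) (y : int -> 'cV[S]_r) :
  uniq s -> (forall d, free_piece d (y d)) -> \sum_(d <- s) y d = 0 ->
  forall d, d \in s -> y d = 0.
Proof.
move=> us hy y0 d ds; apply/colP => i; rewrite mxE.
have := mpoly_piece_free us (fun d => hy d i) ds.
by rewrite -(summxE s xpredT y) y0 mxE raddf0.
Qed.

Definition freeGrMod : gradedModType :=
  @GradedModType 'cV[S]_r free_piece free_piece0 free_pieceB free_pieceZ
    free_piece_span free_piece_free.

End Free.

Record homogIdeal := HomogIdeal {
  hideal_pred :> {pred S};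
  hideal0 : 0 \in hideal_pred;
  hidealB : forall p q, p \in hideal_pred -> q \in hideal_pred ->
    p - q \in hideal_pred;
  hidealM : forall a p, p \in hideal_pred -> a * p \in hideal_pred;
  hideal_comp : forall j p, p \in hideal_pred -> pihomog mdeg j p \in hideal_pred
}.

Section Quotient.
Context (I : homogIdeal).

Lemma hideal_zmod_closed : zmod_closed (hideal_pred I).
Proof. by split; [exact: hideal0 | move=> p q; exact: hidealB]. Qed.

HB.instance Definition _ :=
  GRing.isZmodClosed.Build S (hideal_pred I) hideal_zmod_closed.

Definition quotMod : Type := Quotient.quot (hideal_pred I).
HB.instance Definition _ := GRing.Zmodule.on quotMod.

Definition quot_pi (p : S) : quotMod := \pi_(Quotient.quot (hideal_pred I)) p.

Lemma quot_piE p q : (quot_pi p = quot_pi q) <-> p - q \in hideal_pred I.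
Proof.
rewrite Quotient.idealrBE.
by split=> [/eqP|/eqP].
Qed.

Lemma quot_pi_is_additive : zmod_morphism quot_pi.
Proof. by move=> p q; rewrite /quot_pi raddfB. Qed.

HB.instance Definition _ :=
  GRing.isZmodMorphism.Build S quotMod quot_pi quot_pi_is_additive.

Lemma quot_pi_surj (x : quotMod) : exists p, x = quot_pi p.
Proof. by exists (repr x); rewrite /quot_pi reprK. Qed.

Definition quot_scale (a : S) (x : quotMod) : quotMod :=
  quot_pi (a * repr (x : Quotient.quot (hideal_pred I))).

Lemma quot_scale_pi a p : quot_scale a (quot_pi p) = quot_pi (a * p).
Proof.
apply/quot_piE; rewrite -mulrBr; apply: hidealM.
by apply/quot_piE; rewrite /quot_pi reprK.
Qed.

Lemma quot_scaleA a b x :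
  quot_scale a (quot_scale b x) = quot_scale (a * b) x.
Proof. by have [p ->] := quot_pi_surj x; rewrite !quot_scale_pi mulrA. Qed.

Lemma quot_scale1 : left_id 1 quot_scale.
Proof.
by move=> x; have [p ->] := quot_pi_surj x; rewrite quot_scale_pi mul1r.
Qed.

Lemma quot_scaleDr : right_distributive quot_scale +%R.
Proof.
move=> a x y; have [p ->] := quot_pi_surj x; have [q ->] := quot_pi_surj y.
by rewrite -raddfD !quot_scale_pi mulrDr raddfD.
Qed.

Lemma quot_scaleDl x : {morph quot_scale^~ x : a b / a + b}.
Proof.
move=> a b; have [p ->] := quot_pi_surj x.
by rewrite !quot_scale_pi mulrDl raddfD.
Qed.

HB.instance Definition _ := GRing.Zmodule_isLmodule.Build S quotMod
  quot_scaleA quot_scale1 quot_scaleDr quot_scaleDl.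

Definition quot_piece (d : int) (x : quotMod) : Prop :=
  exists2 p, mpoly_piece d p & x = quot_pi p.

Lemma quot_piece0 d : quot_piece d 0.
Proof. by exists 0; [exact: mpoly_piece0 | rewrite raddf0]. Qed.

Lemma quot_pieceB d x y :
  quot_piece d x -> quot_piece d y -> quot_piece d (x - y).
Proof.
move=> [p hp ->] [q hq ->]; exists (p - q); last by rewrite raddfB.
exact: mpoly_pieceB.
Qed.

Lemma quot_pieceZ d e a x :
  mpoly_piece d a -> quot_piece e x -> quot_piece (d + e) (a *: x).
Proof.
move=> ha [p hp ->]; exists (a * p); first exact: mpoly_pieceM.
exact: quot_scale_pi.
Qed.

Lemma quot_piece_span (x : quotMod) : exists2 s : seq quotMod,
  forall y, y \in s -> exists d, quot_piece d y & x = \sum_(y <- s) y.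
Proof.
have [p ->] := quot_pi_surj x.
exists [seq quot_pi (pihomog mdeg (j : 'I_(msize p)) p) | j <- enum 'I_(msize p)].
  move=> y /mapP [j _ ->]; exists (Posz j), (pihomog mdeg j p) => //.
  exact: pihomogP.
by rewrite big_map big_enum /= -raddf_sum -pihomog_partitionE.
Qed.

Lemma quot_piece_free (s : seq int) (y : int -> quotMod) :
  uniq s -> (forall d, quot_piece d (y d)) -> \sum_(d <- s) y d = 0 ->
  forall d, d \in s -> y d = 0.
Proof.
move=> us hy y0 d ds.
have /choice [q hq] : forall d, exists p, mpoly_piece d p /\ y d = quot_pi p.
  by move=> d'; have [p] := hy d'; exists p.
have hq0 d' : mpoly_piece (0 + d') (q d') by rewrite add0r; case: (hq d').
have := mpoly_piece_free us hq0 ds; rewrite add0r => qE.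
have [_ ->] := hq d; rewrite -(raddf0 quot_pi); apply/quot_piE.
rewrite subr0 -qE.
have : \sum_(d0 <- s) q d0 \in hideal_pred I.
  rewrite -[X in X \in _]subr0; apply/quot_piE; rewrite raddf0 raddf_sum -[RHS]y0.
  by apply: eq_bigr => d' _; case: (hq d').
by case: (d) => j /= h; [exact: hideal_comp | exact: hideal0].
Qed.

Definition quotGrMod : gradedModType :=
  @GradedModType quotMod quot_piece quot_piece0 quot_pieceB quot_pieceZ
    quot_piece_span quot_piece_free.

End Quotient.

Definition ideal_gen (P : S -> Prop) (p : S) : Prop :=
  exists r (a h : 'I_r -> S),
    (forall i, P (h i)) /\ p = \sum_(i < r) a i * h i.

Lemma ideal_gen0 P : ideal_gen P 0.
Proof.
by exists 0%N, (fun=> 0), (fun=> 0); split; [case | rewrite big_ord0].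
Qed.

Lemma ideal_genM P a p : ideal_gen P p -> ideal_gen P (a * p).
Proof.
move=> [r [b [h [Ph ->]]]]; exists r, (fun i => a * b i), h; split=> //.
by rewrite mulr_sumr; apply: eq_bigr => i _; rewrite mulrA.
Qed.

Lemma ideal_genD P p q : ideal_gen P p -> ideal_gen P q -> ideal_gen P (p + q).
Proof.
move=> [r [a [h [Ph ->]]]] [s [b [g [Pg ->]]]].
pose glue (u : 'I_r -> S) (v : 'I_s -> S) i :=
  match split i with inl j => u j | inr j => v j end.
exists (r + s)%N, (glue a b), (glue h g); split=> [i|].
  by rewrite /glue; case: split.
rewrite big_split_ord /=; congr (_ + _); apply: eq_bigr => i _; rewrite /glue.
  by case: split_ordP => j /eqP; rewrite ?eq_shift // => /eqP ->.
by case: split_ordP => j /eqP; rewrite ?eq_shift // => /eqP ->.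
Qed.

Lemma ideal_genB P p q : ideal_gen P p -> ideal_gen P q -> ideal_gen P (p - q).
Proof.
by move=> hp hq; apply: ideal_genD => //; rewrite -mulN1r; exact: ideal_genM.
Qed.

Lemma ideal_gen_sum P (r : nat) (p : 'I_r -> S) :
  (forall i, ideal_gen P (p i)) -> ideal_gen P (\sum_i p i).
Proof.
move=> h; elim/big_ind: _ => //; [exact: ideal_gen0 | exact: ideal_genD].
Qed.

Lemma ideal_gen_comp P (Phom : forall h, P h -> h \is homog mdeg) j p :
  ideal_gen P p -> ideal_gen P (pihomog mdeg j p).
Proof.
move=> [r [a [h [Ph ->]]]]; rewrite raddf_sum; apply: ideal_gen_sum => i.
have /homogP [e he] := Phom _ (Ph i).
rewrite [a i](@pihomog_partitionE _ _ mdeg _ _ (leqnn _)) mulr_suml raddf_sum.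
apply: ideal_gen_sum => c /=.
have hc := dhomogM (pihomogP mdeg c (a i)) he.
have [E|ne] := eqVneq (c + e)%N j.
  rewrite pihomog_dE -?E //; apply: ideal_genM.
  by exists 1%N, (fun=> 1), (fun=> h i); rewrite big_ord1 mul1r.
by rewrite (pihomog_ne0 ne hc); exact: ideal_gen0.
Qed.

(* A set X of points of projective space is represented by the predicate of    *)
(* being a homogeneous coordinate vector of a point of X.                      *)
Definition homog_vanishing (X : ('I_n -> k) -> Prop) (h : S) : Prop :=
  h \is homog mdeg /\ forall b, X b -> h.@[b] = 0.

Section VanishingIdeal.
Context (X : ('I_n -> k) -> Prop).

Definition proj_ideal_pred : {pred S} :=
  fun p => `[< ideal_gen (homog_vanishing X) p >].

Fact proj_ideal0 : 0 \in proj_ideal_pred.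
Proof. by apply/asboolP; exact: ideal_gen0. Qed.

Fact proj_idealB p q : p \in proj_ideal_pred -> q \in proj_ideal_pred ->
  p - q \in proj_ideal_pred.
Proof. by move=> /asboolP hp /asboolP hq; apply/asboolP; exact: ideal_genB. Qed.

Fact proj_idealM a p : p \in proj_ideal_pred -> a * p \in proj_ideal_pred.
Proof. by move=> /asboolP hp; apply/asboolP; exact: ideal_genM. Qed.

Fact proj_ideal_comp j p :
  p \in proj_ideal_pred -> pihomog mdeg j p \in proj_ideal_pred.
Proof.
by move=> /asboolP hp; apply/asboolP; apply: ideal_gen_comp hp => h [].
Qed.

Definition proj_ideal : homogIdeal :=
  HomogIdeal proj_ideal0 proj_idealB proj_idealM proj_ideal_comp.

End VanishingIdeal.

End GradedModules.

Section Veronese.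
Context (k : fieldType).
Local Notation S := {mpoly k[6]}.

Definition plane_curve (f : {mpoly k[3]}) (a : 'I_3 -> k) : Prop :=
  (exists i, a i != 0) /\ f.@[a] = 0.

Definition veronese (a : 'I_3 -> k) : 'I_6 -> k :=
  let a0 := a (@Ordinal 3 0 isT) in
  let a1 := a (@Ordinal 3 1 isT) in
  let a2 := a (@Ordinal 3 2 isT) in
  tnth [tuple a0 ^+ 2; a0 * a1; a0 * a2; a1 ^+ 2; a1 * a2; a2 ^+ 2].

(* all homogeneous coordinate vectors of the points of sigma(C) *)
Definition veronese_image (C : ('I_3 -> k) -> Prop) (b : 'I_6 -> k) : Prop :=
  exists2 a, C a & exists2 c : k, c != 0 & forall i, b i = c * veronese a i.

Definition x00 : S := 'X_(@Ordinal 6 0 isT).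
Definition x01 : S := 'X_(@Ordinal 6 1 isT).
Definition x02 : S := 'X_(@Ordinal 6 2 isT).
Definition x11 : S := 'X_(@Ordinal 6 3 isT).
Definition x12 : S := 'X_(@Ordinal 6 4 isT).
Definition x22 : S := 'X_(@Ordinal 6 5 isT).

Section LiftedEquation.
Context (m : nat) (f : {mpoly k[3]}).

Let a (i j l : nat) : k := f@_[multinom [tuple i; j; l]].

Let sum_exp (P : nat -> nat -> nat -> bool) (E : nat -> nat -> nat -> S) : S :=
  \sum_(i < (2 * m).+1) \sum_(j < (2 * m).+1)
    \sum_(l < (2 * m).+1 | (i + j + l == 2 * m)%N && P i j l) E i j l.

Definition lifted_eq : S :=
    sum_exp (fun i j l => [&& ~~ odd i, ~~ odd j & ~~ odd l])
      (fun i j l => a i j l *: (x00 ^+ i./2 * x11 ^+ j./2 * x22 ^+ l./2))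
  + sum_exp (fun i j l => [&& ~~ odd i, odd j & odd l])
      (fun i j l =>
         a i j l *: (x00 ^+ i./2 * x11 ^+ j.-1./2 * x22 ^+ l.-1./2 * x12))
  + sum_exp (fun i j l => [&& ~~ odd j, odd i & odd l])
      (fun i j l =>
         a i j l *: (x00 ^+ i.-1./2 * x11 ^+ j./2 * x22 ^+ l.-1./2 * x02))
  + sum_exp (fun i j l => [&& ~~ odd l, odd i & odd j])
      (fun i j l =>
         a i j l *: (x00 ^+ i.-1./2 * x11 ^+ j.-1./2 * x22 ^+ l./2 * x01)).

End LiftedEquation.

Definition mx_of_rows (p q : nat) (rows : seq (seq S)) : 'M[S]_(p, q) :=
  \matrix_(i < p, j < q) nth 0 (nth [::] rows i) j.

Definition M1 : 'M[S]_(1, 6) := mx_of_rows 1 6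
  [:: [:: x11 * x22 - x12 ^+ 2; x01 * x22 - x12 * x02; x01 * x12 - x02 * x11;
          x00 * x22 - x02 ^+ 2; x00 * x12 - x02 * x01; x00 * x11 - x01 ^+ 2]].

Definition M2 : 'M[S]_(6, 8) := mx_of_rows 6 8
  [:: [::   x02;     0;   x01;     0;     0;   x00;     0;     0];
      [:: - x12;   x02; - x11;   x01;     0;     0;   x00;     0];
      [::   x22;     0;   x12;   x02;   x01;   x02;     0;   x00];
      [::     0; - x12;     0; - x11;     0; - x11; - x01;     0];
      [::     0;   x22;     0;     0; - x11;   x12;   x02; - x01];
      [::     0;     0;     0;   x22;   x12;     0;     0;   x02]].

Definition M3 : 'M[S]_(8, 3) := mx_of_rows 8 3
  [:: [::   x01;   x00;     0];
      [:: - x11; - x01;     0];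
      [:: - x02;     0;   x00];
      [::   x12;   x02;     0];
      [:: - x22;     0;   x02];
      [::     0; - x02; - x01];
      [::     0;   x12;   x11];
      [::     0; - x22; - x12]].

Context (F : S).

Definition M1' : 'M[S]_(1, 6 + 1) := row_mx M1 F%:M.
Definition M2' : 'M[S]_(6 + 1, 8 + 6) := block_mx M2 (- F%:M) 0 M1.
Definition M3' : 'M[S]_(8 + 6, 3 + 8) := block_mx M3 F%:M 0 M2.
Definition M4' : 'M[S]_(3 + 8, 3) := col_mx (- F%:M) M3.

End Veronese.

(* degree vectors: S(d)^p and S(d)^p (+) S(e)^q *)
Definition twist1 (p : nat) (d : int) : 'cV[int]_p := const_mx d.
Definition twist2 (p q : nat) (d e : int) : 'cV[int]_(p + q) :=
  col_mx (twist1 p d) (twist1 q e).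

(* Main.v *)
(* Over A = k[x00, x11, x22] the six minors in M1 have as top forms in x01, x02, x12
   all quadratic monomials in these variables.  They form a Pommaret basis, with x01
   multiplicative for every minor, x02 for those indexed 0, 1, 3 and x12 only for the
   first; each column of M2 rewrites one nonmultiplicative multiple of a minor, and M3
   arises from M2 in the same way.  Hence every vector is congruent modulo the image of
   the next map to a reduced one, reduced vectors are mapped injectively, and
   0 -> S^3 -> S^8 -> S^6 -> S is exact.  The quotient of S by the image of M1 is the free
   A-module on 1, x01, x02, x12, which embeds into k[x0, x1, x2] by x_ij |-> x_i x_j (look
   at the parities of the exponents), so the image of M1 is the prime ideal of the
   Veronese surface.

   As F maps to f <> 0, it is a nonzerodivisor modulo this prime, and the four matrices
   M1', ..., M4' form the mapping cone of multiplication by F.  Finally, an h that vanishes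
   on the curve maps to a form vanishing on Z(f), i.e. to f g by the Nullstellensatz for a
   hypersurface, and only the even part of g matters, which lifts to some G in S; so
   h - F G lies in the image of M1.  The Nullstellensatz is proved by induction on the
   number of variables, eliminating one variable by a resultant; this uses that polynomial
   rings are factorial. *)
Require Import Defs.
From HB Require Import structures.
From mathcomp Require Import all_boot all_order all_algebra.
From mathcomp Require Import ring_quotient boolp mpoly.
From mathcomp Require Import ring zify.

Set Implicit Arguments.
Unset Strict Implicit.
Unset Printing Implicit Defensive.

Import GRing.Theory.
Local Open Scope ring_scope.

(** * Polynomials that do not involve a given variable *)

Lemma mpoly_ind_mulX (n : nat) (k : comNzRingType) (P : {mpoly k[n]} -> Prop) :
    (forall c, P c%:MP) -> (forall p q, P p -> P q -> P (p + q)) ->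
    (forall i p, P p -> P ('X_i * p)) ->
  forall p, P p.
Proof.
move=> PC PD PX; elim/mpolyind => [|c m p _ _ IH]; first by rewrite -mpolyC0.
apply: PD => //; rewrite mpolyXE_id -mul_mpolyC mulrC.
elim/big_rec: _ => [|i q _ Pq]; first by rewrite mul1r.
rewrite -mulrA; elim: (m i) => [|d IHd]; first by rewrite expr0 mul1r.
by rewrite exprS -mulrA; exact: PX.
Qed.

(** If q were nonzero, the first summand would have degree at least 2, whereas the other two have
    degree at most 1. *)
Lemma monic_quadratic_poly (R : nzRingType) (c a b : R) (q : {poly R}) :
  ('X^2 - c%:P) * q + 'X * a%:P + b%:P = 0 -> [/\ q = 0, a = 0 & b = 0].
Proof.
move=> E; have q0 : q = 0.
  apply/eqP/negPn/negP => qn0.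
  have mon : 'X^2 - c%:P \is monic by rewrite monicXnsubC.
  have : leq (size (('X^2 - c%:P) * q)) 2.
    have -> : ('X^2 - c%:P) * q = - ('X * a%:P + b%:P).
      by apply/eqP; rewrite -addr_eq0 addrA E.
    rewrite size_polyN -commr_polyX mul_polyC.
    apply: leq_trans (size_polyD _ _) _.
    rewrite geq_max (leq_trans (size_polyC_leq1 _)) // andbT.
    by apply: leq_trans (size_scale_leq _ _) _; rewrite size_polyX.
  rewrite size_monicM // size_XnsubC //.
  by move: qn0; rewrite -size_poly_gt0; case: (size _).
move: E; rewrite q0 mulr0 add0r => E; split=> //.
  have := congr1 (fun p : {poly R} => p`_1) E.
  by rewrite coefD coefXM !coefC /= addr0.
have := congr1 (fun p : {poly R} => p`_0) E.
by rewrite coefD coefXM !coefC /= add0r.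
Qed.

Section FreeOfVariable.
Context (k : fieldType) (n : nat).
Local Notation S := {mpoly k[n]}.
Implicit Types (i j : 'I_n) (p q a b : S) (c : k).

(** The coefficients stay in the full ring [S] instead of a ring with one variable less, so that one
    type serves for every choice of the variable. *)
Definition as_poly i : S -> {poly S} :=
  mmap (polyC \o @mpolyC n k) (fun j => if j == i then 'X else ('X_j)%:P).

Lemma as_polyD i : {morph as_poly i : p q / p + q}. Proof. exact: mmapD. Qed.
Lemma as_polyN i : {morph as_poly i : p / - p}. Proof. exact: mmapN. Qed.
Lemma as_polyM i : {morph as_poly i : p q / p * q}. Proof. exact: rmorphM. Qed.

Definition free_of i p : Prop := as_poly i p = p%:P.

Lemma as_polyC i c : as_poly i c%:MP = (c%:MP)%:P.
Proof. by rewrite /as_poly mmapC. Qed.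

Lemma as_polyX i j : as_poly i 'X_j = if j == i then 'X else ('X_j)%:P.
Proof. by rewrite /as_poly mmapX mmap1U. Qed.

Lemma as_polyK i p : (as_poly i p).['X_i] = p.
Proof.
elim/mpoly_ind_mulX: p => [c|p q IHp IHq|j p IHp].
- by rewrite as_polyC hornerC.
- rewrite as_polyD; move: (as_poly i p) (as_poly i q) IHp IHq => a b <- <-.
  exact: hornerD.
- rewrite as_polyM; move: (as_poly i p) IHp => a <-; rewrite hornerM as_polyX.
  by case: eqP => [->|_]; rewrite ?hornerX ?hornerC.
Qed.

Lemma free_ofC i c : free_of i c%:MP. Proof. exact: as_polyC. Qed.
Lemma free_of0 i : free_of i 0. Proof. by rewrite -mpolyC0; exact: free_ofC. Qed.
Lemma free_ofX i j : j != i -> free_of i 'X_j.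
Proof. by rewrite /free_of as_polyX => /negPf ->. Qed.
Lemma free_ofD i p q : free_of i p -> free_of i q -> free_of i (p + q).
Proof. by rewrite /free_of as_polyD polyCD => -> ->. Qed.
Lemma free_ofN i p : free_of i p -> free_of i (- p).
Proof. by rewrite /free_of as_polyN polyCN => ->. Qed.
Lemma free_ofB i p q : free_of i p -> free_of i q -> free_of i (p - q).
Proof. by move=> hp hq; apply: free_ofD (free_ofN hq). Qed.
Lemma free_ofM i p q : free_of i p -> free_of i q -> free_of i (p * q).
Proof. by rewrite /free_of as_polyM polyCM => -> ->. Qed.

Lemma monic_quadratic_free i (c q a b : S) :
    free_of i c -> free_of i a -> free_of i b ->
    ('X_i ^+ 2 - c) * q + 'X_i * a + b = 0 ->
  [/\ q = 0, a = 0 & b = 0].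
Proof.
move=> hc ha hb /(congr1 (as_poly i)); rewrite [RHS]mmap0.
rewrite !(as_polyD, as_polyM, as_polyN) as_polyX eqxx hc ha hb.
move=> /monic_quadratic_poly [q0 -> ->]; split=> //.
by rewrite -[q](as_polyK i) q0 horner0.
Qed.

End FreeOfVariable.

(** * The resolution of the Veronese surface *)

Lemma mulf_eq0l (R : idomainType) (x y : R) : x != 0 -> x * y = 0 -> y = 0.
Proof. by move=> x0 /eqP; rewrite mulf_eq0 (negPf x0) => /eqP. Qed.

(** * Injectivity on reduced vectors *)

Section ReducedInjectivity.
Context (R : idomainType) (x00 x01 x02 x11 x12 x22 : R) (P1 P2 : R -> Prop).

(** Over the subring [P] the element y behaves like a variable: division by y^2 - c has a unique
    quotient and remainder. Below, [P1] and [P2] stand for the subrings A[x01] and A[x01, x02]. *)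
Definition quadratic_free (y : R) (P : R -> Prop) := forall c q a b,
  P c -> P a -> P b -> (y ^+ 2 - c) * q + y * a + b = 0 ->
  [/\ q = 0, a = 0 & b = 0].

Hypotheses (q2 : quadratic_free x02 P1) (q3 : quadratic_free x12 P2).
Hypotheses (P12 : forall p, P1 p -> P2 p) (P1_0 : P1 0).
Hypotheses (P1B : forall p q, P1 p -> P1 q -> P1 (p - q)).
Hypotheses (P1M : forall p q, P1 p -> P1 q -> P1 (p * q)).
Hypotheses (P2B : forall p q, P2 p -> P2 q -> P2 (p - q)).
Hypotheses (P2M : forall p q, P2 p -> P2 q -> P2 (p * q)).
Hypotheses (P1_00 : P1 x00) (P1_01 : P1 x01) (P1_11 : P1 x11) (P1_22 : P1 x22).
Hypothesis P2_02 : P2 x02.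
Hypotheses (x00_neq0 : x00 != 0) (disc_neq0 : x01 ^+ 2 - x00 * x11 != 0).

Local Hint Resolve P12 P1B P1M P2B P2M P1_0 P1_00 P1_01 P1_11 P1_22 P2_02 : core.

Let P2N p : P2 p -> P2 (- p). Proof. by rewrite -sub0r; auto. Qed.
Let P1N p : P1 p -> P1 (- p). Proof. by rewrite -sub0r; auto. Qed.
Let P2D p q : P2 p -> P2 q -> P2 (p + q).
Proof. by rewrite -[q in p + q]opprK; auto. Qed.
Let P1D p q : P1 p -> P1 q -> P1 (p + q).
Proof. by rewrite -[q in p + q]opprK; auto. Qed.
Local Hint Resolve P2N P1N P2D P1D : core.

Let lin2 q b : P1 b -> x02 * q + b = 0 -> q = 0 /\ b = 0.
Proof.
move=> hb E; have [] // := @q2 0 q b 0; auto.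
(* The extra factor x02 turns the linear equation into a quadratic one with c = 0. *)
transitivity (x02 * (x02 * q + b)); first by ring.
by rewrite E mulr0.
Qed.

Let lin3 q b : P2 b -> x12 * q + b = 0 -> q = 0 /\ b = 0.
Proof.
move=> hb E; have [] // := @q3 0 q b 0; auto.
transitivity (x12 * (x12 * q + b)); first by ring.
by rewrite E mulr0.
Qed.

(** The coefficients are compared first in x12 over A[x01, x02], then in x02 over A[x01]. What
    remains for n2 and n4 is a 2 x 2 system with determinant x00 x11 - x01^2. *)
Lemma M1_reduced_inj n0 n1 n2 n3 n4 n5 :
    P2 n1 -> P2 n3 -> P1 n2 -> P1 n4 -> P1 n5 ->
    (x11 * x22 - x12 ^+ 2) * n0 + (x01 * x22 - x12 * x02) * n1
    + (x01 * x12 - x02 * x11) * n2 + (x00 * x22 - x02 ^+ 2) * n3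
    + (x00 * x12 - x02 * x01) * n4 + (x00 * x11 - x01 ^+ 2) * n5 = 0 ->
  [/\ n0 = 0, n1 = 0, n2 = 0 & [/\ n3 = 0, n4 = 0 & n5 = 0]].
Proof.
move=> h1 h3 h2 h4 h5 E.
(* The minor multiplying n0 is -(x12^2 - x11 x22), which explains both c and the sign of the
   quotient. *)
have [] := @q3 (x11 * x22) (- n0) (- (x02 * n1) + (x01 * n2 + x00 * n4))
  (x01 * x22 * n1 - x02 * x11 * n2 + (x00 * x22 - x02 * x02) * n3
   - x02 * x01 * n4 + (x00 * x11 - x01 * x01) * n5); auto 10.
  by rewrite -[RHS]E; ring.
move=> /eqP; rewrite oppr_eq0 => /eqP -> E1 E0.
have [] := @lin2 (- n1) (x01 * n2 + x00 * n4); auto.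
  by rewrite -[RHS]E1; ring.
move=> /eqP; rewrite oppr_eq0 => /eqP n10 E2; subst n1.
have [] := @q2 (x00 * x22) (- n3) (- (x11 * n2) - x01 * n4)
  ((x00 * x11 - x01 * x01) * n5); auto 10.
  by rewrite -[RHS]E0; ring.
move=> /eqP; rewrite oppr_eq0 => /eqP -> E3 E4.
have -> : n5 = 0.
  by apply: (mulf_eq0l disc_neq0); rewrite -[RHS]oppr0 -E4; ring.
have -> : n2 = 0.
  apply: (mulf_eq0l disc_neq0).
  transitivity (x01 * (x01 * n2 + x00 * n4) + x00 * (- (x11 * n2) - x01 * n4)).
    by ring.
  by rewrite E2 E3; ring.
have -> // : n4 = 0.
apply: (mulf_eq0l disc_neq0).
transitivity (- x01 * (- (x11 * n2) - x01 * n4) - x11 * (x01 * n2 + x00 * n4)).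
  by ring.
by rewrite E2 E3; ring.
Qed.

Lemma M2_reduced_inj n0 n1 n2 n3 n4 n5 n6 n7 :
    P2 n3 -> P2 n6 -> P2 n7 ->
    x02 * n0 + x01 * n2 + x00 * n5 = 0 ->
    - x12 * n0 + x02 * n1 - x11 * n2 + x01 * n3 + x00 * n6 = 0 ->
    x22 * n0 + x12 * n2 + x02 * n3 + x01 * n4 + x02 * n5 + x00 * n7 = 0 ->
    - x12 * n1 - x11 * n3 - x11 * n5 - x01 * n6 = 0 ->
    x22 * n1 - x11 * n4 + x12 * n5 + x02 * n6 - x01 * n7 = 0 ->
    x22 * n3 + x12 * n4 + x02 * n7 = 0 ->
  [/\ n0 = 0, n1 = 0, n2 = 0 & n3 = 0] /\
  [/\ n4 = 0, n5 = 0, n6 = 0 & n7 = 0].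
Proof.
move=> h3 h6 h7 E0 E1 E2 E3 E4 E5.
have [n40 _] : n4 = 0 /\ x22 * n3 + x02 * n7 = 0.
  by apply: lin3; auto 10; rewrite -[RHS]E5; ring.
subst n4.
(* The combination -x12 E3 - x11 E4 cancels n5 and gives n1 the coefficient x12^2 - x11 x22. Below,
   E1 and E2 are combined in the same way to cancel n2 and isolate n0. *)
have [n10 _ _] : [/\ n1 = 0, x11 * n3 + x01 * n6 = 0
    & - (x11 * (x02 * n6 - x01 * n7)) = 0].
  apply: (@q3 (x11 * x22)); auto 10.
  transitivity (- x12 * (- x12 * n1 - x11 * n3 - x11 * n5 - x01 * n6)
    - x11 * (x22 * n1 - x11 * 0 + x12 * n5 + x02 * n6 - x01 * n7)).
    by ring.
  by rewrite E3 E4; ring.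
subst n1.
have [n50 _] : n5 = 0 /\ x02 * n6 - x01 * n7 = 0.
  by apply: lin3; auto 10; rewrite -[RHS]E4; ring.
subst n5.
have [n00 _ _] : [/\ n0 = 0, - (x01 * n3 + x00 * n6) = 0
    & - (x11 * (x02 * n3 + x00 * n7)) = 0].
  apply: (@q3 (x11 * x22)); auto 10.
  transitivity (- x12 * (- x12 * n0 + x02 * 0 - x11 * n2 + x01 * n3 + x00 * n6)
    - x11 * (x22 * n0 + x12 * n2 + x02 * n3 + x01 * 0 + x02 * 0 + x00 * n7)).
    by ring.
  by rewrite E1 E2; ring.
subst n0.
have [n20 E2'] : n2 = 0 /\ x02 * n3 + x00 * n7 = 0.
  by apply: lin3; auto 10; rewrite -[RHS]E2; ring.
subst n2.
have n30 : n3 = 0.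
  apply: (mulf_eq0l disc_neq0).
  transitivity (x01 * (- x12 * 0 + x02 * 0 - x11 * 0 + x01 * n3 + x00 * n6)
    + x00 * (- x12 * 0 - x11 * n3 - x11 * 0 - x01 * n6)); first by ring.
  by rewrite E1 E3; ring.
subst n3.
have n60 : n6 = 0.
  by apply: (mulf_eq0l x00_neq0); rewrite -[RHS]E1; ring.
have n70 : n7 = 0.
  by apply: (mulf_eq0l x00_neq0); rewrite -[RHS]E2'; ring.
by [].
Qed.

End ReducedInjectivity.

(** A polynomial free of X_i is its own constant coefficient in X_i. The induction runs over
    constant coefficients of arbitrary polynomials, where a factor X_i simply gives 0. *)
Lemma free_of_ind (k : fieldType) (n : nat) (i : 'I_n) (P : {mpoly k[n]} -> Prop) :
    (forall c, P c%:MP) -> (forall p q, P p -> P q -> P (p + q)) ->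
    (forall j p, j != i -> P p -> P ('X_j * p)) ->
  forall p, free_of i p -> P p.
Proof.
move=> PC PD PX p hp.
suff h q : P ((as_poly i q)`_0) by have := h p; rewrite hp coefC eqxx.
elim/mpoly_ind_mulX: q => [c|a b IHa IHb|j a IHa].
- by rewrite as_polyC coefC eqxx.
- by rewrite as_polyD coefD; exact: PD.
- rewrite as_polyM as_polyX; case: eqVneq => [_|ne].
    by rewrite coefXM /= -mpolyC0; exact: PC.
  by rewrite coefCM; exact: PX.
Qed.

(** * Reduction of vectors modulo the image of a matrix *)

Section Reduction.
Context (k : fieldType).
Local Notation S := {mpoly k[6]}.
Local Notation o i := (@Ordinal 6 i isT).

(* The subrings S, A[x01, x02] and A[x01] of S, for l = 0, 1 and l >= 2. *)
Definition lev_pred (l : nat) (p : S) : Prop :=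
  match l with
  | 0 => True
  | 1 => free_of (o 4) p
  | _ => free_of (o 4) p /\ free_of (o 2) p
  end.

Lemma lev_pred0 l : lev_pred l 0.
Proof. by case: l => [|[|l]] //=; repeat split; exact: free_of0. Qed.

Lemma lev_predD l p q : lev_pred l p -> lev_pred l q -> lev_pred l (p + q).
Proof.
by case: l => [|[|l]] //=; [|move=> [h h'] [h1 h1']; split]; exact: free_ofD.
Qed.

Lemma lev_predM l p q : lev_pred l p -> lev_pred l q -> lev_pred l (p * q).
Proof.
by case: l => [|[|l]] //=; [|move=> [h h'] [h1 h1']; split]; exact: free_ofM.
Qed.

Lemma lev_predC l c : lev_pred l c%:MP.
Proof. by case: l => [|[|l]] //=; repeat split; exact: free_ofC. Qed.

Lemma lev_predX l (i : 'I_6) : (0 < l -> i != 4 :> nat)%N -> (1 < l -> i != 2 :> nat)%N ->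
  lev_pred l ('X_i : S).
Proof.
by case: l => [|[|l]] //= h4 h2; repeat split; apply: free_ofX;
  rewrite -val_eqE /=; auto.
Qed.

Section Module.
Context (p q : nat) (M : 'M[S]_(p, q)) (lev : 'I_p -> nat).

Definition reduced (v : 'cV[S]_p) : Prop := forall i, lev_pred (lev i) (v i 0).
Definition reducible (v : 'cV[S]_p) : Prop := exists w, reduced (v - M *m w).

Lemma reducedD u v : reduced u -> reduced v -> reduced (u + v).
Proof. by move=> hu hv i; rewrite mxE; exact: lev_predD. Qed.

Lemma reducibleD u v : reducible u -> reducible v -> reducible (u + v).
Proof.
move=> [w hw] [z hz]; exists (w + z).
by rewrite mulmxDr opprD addrACA; exact: reducedD.
Qed.

Lemma reducible_sum (r : seq 'I_p) (F : 'I_p -> 'cV[S]_p) :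
  (forall i, reducible (F i)) -> reducible (\sum_(i <- r) F i).
Proof.
move=> hF; elim/big_ind: _ => //; last exact: reducibleD.
by exists 0 => i; rewrite mulmx0 subr0 mxE; exact: lev_pred0.
Qed.

Definition evec (j : 'I_p) : 'cV[S]_p := delta_mx j 0.

Lemma col_sum_evec (v : 'cV[S]_p) : v = \sum_j v j 0 *: evec j.
Proof.
rewrite [LHS]matrix_sum_delta; apply: eq_bigr => j _.
by rewrite big_ord1.
Qed.

Hypothesis lev_le2 : forall j, (lev j <= 2)%N.
Hypothesis red_x02 : forall j, lev j = 2 -> reducible (x02 k *: evec j).
Hypothesis red_x12 : forall j, (0 < lev j)%N -> reducible (x12 k *: evec j).

Lemma reduced_scale_evec a j : lev_pred (lev j) a -> reduced (a *: evec j).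
Proof.
move=> ha i; rewrite !mxE andbT; case: eqP => [->|_]; first by rewrite mulr1.
by rewrite mulr0; exact: lev_pred0.
Qed.

Lemma reducible_reduced v : reduced v -> reducible v.
Proof. by exists 0; rewrite mulmx0 subr0. Qed.


(** A[x01] lies in the coefficient ring of every level, so multiplying by it preserves reduced
    vectors. The admissible multipliers then grow in the order A[x01], x02, A[x01, x02], x12, S,
    each step by structural induction from the preceding ones. *)
Lemma reducible_lev2 a v : lev_pred 2 a -> reducible v -> reducible (a *: v).
Proof.
move=> ha [w hw]; exists (a *: w); rewrite -scalemxAr -scalerBr => i; rewrite mxE.
apply: lev_predM (hw i).
by case: (lev i) (lev_le2 i) ha => [|[|[|]]] //= _ [].
Qed.

(** An entry of level at most 1 stays reduced when multiplied by x02. An entry of level 2 lies in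
    A[x01] and becomes a multiplier of the reducible vector x02 e_j. *)
Lemma reducible_X2 v : reducible v -> reducible (x02 k *: v).
Proof.
move=> [w hw]; set n := v - _ in hw.
have -> : v = M *m w + n by rewrite addrC subrK.
rewrite scalerDr; apply: reducibleD.
  by exists (x02 k *: w) => i; rewrite scalemxAr subrr mxE; exact: lev_pred0.
rewrite (col_sum_evec n) scaler_sumr; apply: reducible_sum => j.
have [l2|ln2] := eqVneq (lev j) 2.
  rewrite scalerA mulrC -scalerA; apply: reducible_lev2; last exact: red_x02.
  by have := hw j; rewrite l2.
rewrite scalerA; apply: reducible_reduced; apply: reduced_scale_evec.
apply: lev_predM (hw j); apply: lev_predX => //.
by case: (lev j) (lev_le2 j) ln2 => [|[|[|]]].
Qed.

Lemma reducible_lev1 a v : lev_pred 1 a -> reducible v -> reducible (a *: v).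
Proof.
move=> ha; elim/free_of_ind: ha v => [c|b c IHb IHc|j b nej IHb] v hv.
- by apply: reducible_lev2 hv; exact: (lev_predC 2).
- by rewrite scalerDl; apply: reducibleD; auto.
- rewrite -scalerA; have [->|ne2] := eqVneq j (o 2).
    by apply: reducible_X2; auto.
  by apply: reducible_lev2; [exact: lev_predX | auto].
Qed.

(** As for x02: an entry of positive level lies in A[x01, x02], whose elements are already known to
    be admissible multipliers of x12 e_j. *)
Lemma reducible_X4 v : reducible v -> reducible (x12 k *: v).
Proof.
move=> [w hw]; set n := v - _ in hw.
have -> : v = M *m w + n by rewrite addrC subrK.
rewrite scalerDr; apply: reducibleD.
  by exists (x12 k *: w) => i; rewrite scalemxAr subrr mxE; exact: lev_pred0.
rewrite (col_sum_evec n) scaler_sumr; apply: reducible_sum => j.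
have [l0|lgt0] := posnP (lev j); last first.
  rewrite scalerA mulrC -scalerA; apply: reducible_lev1; last exact: red_x12.
  by have := hw j; case: (lev j) lgt0 => [|[|l]] //= _ [].
rewrite scalerA; apply: reducible_reduced; apply: reduced_scale_evec.
by rewrite l0.
Qed.

Lemma reducible_all v : reducible v.
Proof.
suff h a u : reducible u -> reducible (a *: u).
  rewrite (col_sum_evec v); apply: reducible_sum => j; apply: h.
  apply: reducible_reduced; rewrite -[evec j]scale1r.
  apply: reduced_scale_evec; rewrite -mpolyC1; exact: lev_predC.
elim/mpoly_ind_mulX: a u => [c|b c IHb IHc|j b IHb] u hu.
- by apply: reducible_lev2 hu; exact: (lev_predC 2).
- by rewrite scalerDl; apply: reducibleD; auto.
- rewrite -scalerA; have [->|ne4] := eqVneq j (o 4).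
    by apply: reducible_X4; auto.
  by apply: reducible_lev1; [exact: lev_predX | auto].
Qed.

End Module.
End Reduction.

Lemma ord6_ind (P : 'I_6 -> Prop) :
    P (@Ordinal 6 0 isT) -> P (@Ordinal 6 1 isT) -> P (@Ordinal 6 2 isT) ->
    P (@Ordinal 6 3 isT) -> P (@Ordinal 6 4 isT) -> P (@Ordinal 6 5 isT) ->
  forall i, P i.
Proof.
move=> h0 h1 h2 h3 h4 h5.
by case=> [[|[|[|[|[|[|i]]]]]] lt_i] //; rewrite (bool_irrelevance lt_i isT).
Qed.

Lemma ord8_ind (P : 'I_8 -> Prop) :
    P (@Ordinal 8 0 isT) -> P (@Ordinal 8 1 isT) -> P (@Ordinal 8 2 isT) ->
    P (@Ordinal 8 3 isT) -> P (@Ordinal 8 4 isT) -> P (@Ordinal 8 5 isT) ->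
    P (@Ordinal 8 6 isT) -> P (@Ordinal 8 7 isT) ->
  forall i, P i.
Proof.
move=> h0 h1 h2 h3 h4 h5 h6 h7.
by case=> [[|[|[|[|[|[|[|[|i]]]]]]]] lt_i] //; rewrite (bool_irrelevance lt_i isT).
Qed.

(** * Exactness of the resolution of the Veronese surface *)

Section VeroneseResolution.
Context (k : fieldType).
Local Notation S := {mpoly k[6]}.
Local Notation o i := (@Ordinal 6 i isT).
Local Notation x00 := (x00 k).
Local Notation x01 := (x01 k).
Local Notation x02 := (x02 k).
Local Notation x11 := (x11 k).
Local Notation x12 := (x12 k).
Local Notation x22 := (x22 k).
Local Notation M1 := (M1 k).
Local Notation M2 := (M2 k).
Local Notation M3 := (M3 k).

Lemma M1M2 : M1 *m M2 = 0.
Proof.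
apply/matrixP => i j; rewrite ord1 !mxE; under eq_bigr do rewrite !mxE.
rewrite !big_ord_recl big_ord0 /=.
case: j => j lt_j /=; move: x00 x01 x02 x11 x12 x22 => a b c d e f.
case: j lt_j => [|[|[|[|[|[|[|[|j]]]]]]]] // _ /=; ring.
Qed.

Lemma M2M3 : M2 *m M3 = 0.
Proof.
apply/matrixP => i j; rewrite !mxE; under eq_bigr do rewrite !mxE.
rewrite !big_ord_recl big_ord0 /=.
case: i => i lt_i; case: j => j lt_j /=; move: x00 x01 x02 x11 x12 x22 => a b c d e f.
case: j lt_j => [|[|[|j]]] // _; case: i lt_i => [|[|[|[|[|[|i]]]]]] // _ /=; ring.
Qed.

(** Indexing by natural numbers lets the product with a concrete matrix unfold to an explicit
    sum. *)
Definition entry q (v : 'cV[S]_q.+1) (j : nat) : S := v (inord j) 0.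

Lemma mul_rows p q rows (v : 'cV[S]_q.+1) (i : 'I_p.+1) :
  (mx_of_rows p.+1 q.+1 rows *m v) i 0 =
  \sum_(j <- iota 0 q.+1) nth 0 (nth [::] rows i) j * entry v j.
Proof.
rewrite -[X in iota _ X]subn0 -/(index_iota 0 q.+1) big_mkord mxE.
by apply: eq_bigr => j _; rewrite mxE /entry inord_val.
Qed.

Lemma entry_eq0 q (v : 'cV[S]_q.+1) :
  (forall j, (j <= q)%N -> entry v j = 0) -> v = 0.
Proof.
move=> h; apply/colP => i; rewrite mxE.
by have := h i; rewrite /entry inord_val; apply; rewrite -ltnS.
Qed.

Lemma M1E (v : 'cV[S]_6) : (M1 *m v) 0 0 =
  (x11 * x22 - x12 ^+ 2) * entry v 0 + (x01 * x22 - x12 * x02) * entry v 1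
  + (x01 * x12 - x02 * x11) * entry v 2 + (x00 * x22 - x02 ^+ 2) * entry v 3
  + (x00 * x12 - x02 * x01) * entry v 4 + (x00 * x11 - x01 ^+ 2) * entry v 5.
Proof. by rewrite mul_rows /= !big_cons big_nil !addrA addr0. Qed.

Lemma M2E (v : 'cV[S]_8) : M2 *m v = 0 ->
  let n := entry v in
  [/\ x02 * n 0%N + x01 * n 2%N + x00 * n 5%N = 0,
      - x12 * n 0%N + x02 * n 1%N - x11 * n 2%N + x01 * n 3%N + x00 * n 6%N = 0,
      x22 * n 0%N + x12 * n 2%N + x02 * n 3%N + x01 * n 4%N + x02 * n 5%N + x00 * n 7%N = 0 &
  [/\ - x12 * n 1%N - x11 * n 3%N - x11 * n 5%N - x01 * n 6%N = 0,
      x22 * n 1%N - x11 * n 4%N + x12 * n 5%N + x02 * n 6%N - x01 * n 7%N = 0 &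
      x22 * n 3%N + x12 * n 4%N + x02 * n 7%N = 0]].
Proof.
move=> E; set n := entry v; move=> /=.
have R i : (M2 *m v) i 0 = 0 by rewrite E mxE.
have r i (lt_i : (i < 6)%N) := R (Ordinal lt_i).
split; last split; [have := r 0 isT|have := r 1 isT|have := r 2 isT
  |have := r 3 isT|have := r 4 isT|have := r 5 isT];
  rewrite mul_rows /= !big_cons big_nil /= -/n => Er; rewrite -[RHS]Er;
  move: x00 x01 x02 x11 x12 x22 => a b c d e f; ring.
Qed.

Lemma M3E (v : 'cV[S]_3) : M3 *m v = 0 ->
  let n := entry v in
  [/\ x01 * n 0%N + x00 * n 1%N = 0, - x11 * n 0%N - x01 * n 1%N = 0 &
      - x02 * n 0%N + x00 * n 2%N = 0].
Proof.
move=> E; set n := entry v; move=> /=.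
have R i : (M3 *m v) i 0 = 0 by rewrite E mxE.
have r i (lt_i : (i < 8)%N) := R (Ordinal lt_i).
split; [have := r 0 isT|have := r 1 isT|have := r 2 isT];
  rewrite mul_rows /= !big_cons big_nil /= -/n => Er; rewrite -[RHS]Er;
  move: x00 x01 x02 x11 x12 x22 => a b c d e f; ring.
Qed.

(* The number of variables among x02, x12 that are not multiplicative for the i-th minor,
   resp. (in lev3) for the i-th syzygy. *)
Definition lev2 (i : 'I_6) : nat := nth 0%N [:: 0; 1; 2; 1; 2; 2]%N i.
Definition lev3 (i : 'I_8) : nat := nth 0%N [:: 0; 0; 0; 1; 0; 0; 1; 1]%N i.

(** Here s times a single column does the whole reduction. In the applications s is the sign with
    which the term to be cancelled occurs in that column. *)
Lemma reducible_col p q (M : 'M[S]_(p, q)) lev (u : 'cV[S]_p) c (s : S) :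
  (forall i, lev_pred (lev i) (u i 0 - s * M i c)) -> reducible M lev u.
Proof.
move=> h; exists (s *: delta_mx c 0) => i.
by rewrite -scalemxAr -colE !mxE.
Qed.

Local Ltac free_entries :=
  let i := fresh "i" in let lt_i := fresh "lt_i" in
  case=> i lt_i; do 8?[case: i lt_i => [|i] lt_i //];
  rewrite !mxE /=; repeat split;
  rewrite ?(mulr1, mul1r, mulr0, mulN1r, opprK, subrr, subr0, sub0r, addr0, add0r);
  repeat first [exact: free_of0 | exact: free_ofX | apply: free_ofN | apply: free_ofD].

Lemma M2_reducible v : reducible M2 lev2 v.
Proof.
(* In each of the next seven cases the chosen column contains the given nonmultiplicative multiple
   up to sign, and its other entries are reduced already. *)
have e2 : reducible M2 lev2 (x02 *: evec k (o 2)).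
  by apply: (@reducible_col _ _ _ _ _ (@Ordinal 8 3 isT) 1); free_entries.
have e4 : reducible M2 lev2 (x02 *: evec k (o 4)).
  by apply: (@reducible_col _ _ _ _ _ (@Ordinal 8 6 isT) 1); free_entries.
have e5 : reducible M2 lev2 (x02 *: evec k (o 5)).
  by apply: (@reducible_col _ _ _ _ _ (@Ordinal 8 7 isT) 1); free_entries.
have f1 : reducible M2 lev2 (x12 *: evec k (o 1)).
  by apply: (@reducible_col _ _ _ _ _ (@Ordinal 8 0 isT) (- 1)); free_entries.
have f2 : reducible M2 lev2 (x12 *: evec k (o 2)).
  by apply: (@reducible_col _ _ _ _ _ (@Ordinal 8 2 isT) 1); free_entries.
have f3 : reducible M2 lev2 (x12 *: evec k (o 3)).
  by apply: (@reducible_col _ _ _ _ _ (@Ordinal 8 1 isT) (- 1)); free_entries.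
have f5 : reducible M2 lev2 (x12 *: evec k (o 5)).
  by apply: (@reducible_col _ _ _ _ _ (@Ordinal 8 4 isT) 1); free_entries.
have lev_le2 j : (lev2 j <= 2)%N by move: j; clear; apply: ord6_ind.
have f4 : reducible M2 lev2 (x12 *: evec k (o 4)).
  (* The column 5 of M2 only reduces x12 e_4 to x02 e_2, which is not reduced either. *)
  have -> : x12 *: evec k (o 4)
      = x12 *: evec k (o 4) + x02 *: evec k (o 2) + - 1 *: (x02 *: evec k (o 2)).
    by rewrite scaleN1r addrK.
  apply: reducibleD.
    by apply: (@reducible_col _ _ _ _ _ (@Ordinal 8 5 isT) 1); free_entries.
  apply: reducible_lev2 e2 => //; rewrite -mpolyC1 -mpolyCN; exact: (lev_predC 2).
(* The indices whose level contradicts h drop out; the eight that remain are the multiples treated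
   above. *)
apply: (reducible_all lev_le2); apply: ord6_ind => h; do ?[by exfalso; clear -h].
- exact: e2.
- exact: e4.
- exact: e5.
- exact: f1.
- exact: f2.
- exact: f3.
- exact: f4.
- exact: f5.
Qed.

Lemma M3_reducible v : reducible M3 lev3 v.
Proof.
have e3 : reducible M3 lev3 (x12 *: evec k (@Ordinal 8 3 isT)).
  by apply: (@reducible_col _ _ _ _ _ (@Ordinal 3 0 isT) 1); free_entries.
have e6 : reducible M3 lev3 (x12 *: evec k (@Ordinal 8 6 isT)).
  by apply: (@reducible_col _ _ _ _ _ (@Ordinal 3 1 isT) 1); free_entries.
have e7 : reducible M3 lev3 (x12 *: evec k (@Ordinal 8 7 isT)).
  by apply: (@reducible_col _ _ _ _ _ (@Ordinal 3 2 isT) (- 1)); free_entries.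
have lev_le2 j : (lev3 j <= 2)%N by move: j; clear; apply: ord8_ind.
apply: (reducible_all lev_le2); apply: ord8_ind => h; do ?[by exfalso; clear -h].
- exact: e3.
- exact: e6.
- exact: e7.
Qed.

Let P1 := @lev_pred k 2.
Let P2 := @lev_pred k 1.

Lemma quadratic_x02 : quadratic_free x02 P1.
Proof. by move=> c q a b [_ hc] [_ ha] [_ hb]; exact: monic_quadratic_free. Qed.

Lemma quadratic_x12 : quadratic_free x12 P2.
Proof. by move=> c q a b hc ha hb; exact: monic_quadratic_free. Qed.

Lemma x00_neq0 : x00 != 0.
Proof. by rewrite -msize_poly_eq0 msizeX. Qed.

Lemma disc_neq0 : x01 ^+ 2 - x00 * x11 != 0.
Proof.
(* If the discriminant vanished, so would the quotient 1 of x01^2 - x00 x11 by itself. *)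
apply/eqP => E; have [] := @monic_quadratic_free _ _ (o 1) (x00 * x11) 1 0 0.
- by apply: free_ofM; exact: free_ofX.
- exact: free_of0.
- exact: free_of0.
- by rewrite mulr1 mulr0 !addr0.
- by move/eqP; rewrite oner_eq0.
Qed.


Lemma lev_predB l p q : lev_pred l p -> lev_pred l q -> lev_pred l (p - q : S).
Proof.
by case: l => [|[|l]] //=; [|move=> [h h'] [h1 h1']; split]; exact: free_ofB.
Qed.

Lemma lev_pred21 p : P1 p -> P2 p. Proof. by case. Qed.

Let lev_x00 : P1 x00. Proof. exact: lev_predX. Qed.
Let lev_x01 : P1 x01. Proof. exact: lev_predX. Qed.
Let lev_x11 : P1 x11. Proof. exact: lev_predX. Qed.
Let lev_x22 : P1 x22. Proof. exact: lev_predX. Qed.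
Let lev_x02 : P2 x02. Proof. exact: lev_predX. Qed.

Lemma M1_reduced_ker v : reduced lev2 v -> M1 *m v = 0 -> v = 0.
Proof.
move=> hv E.
have {}E : (M1 *m v) 0 0 = 0 by rewrite E mxE.
rewrite M1E in E.
have h j : lev_pred (nth 0%N [:: 0; 1; 2; 1; 2; 2]%N (inord j : 'I_6)) (entry v j).
  exact: hv.
have h1 := h 1%N; have h2 := h 2%N; have h3 := h 3%N.
have h4 := h 4%N; have h5 := h 5%N.
rewrite !inordK //= in h1 h2 h3 h4 h5.
have [n0 n1 n2 [n3 n4 n5]] := M1_reduced_inj quadratic_x02 quadratic_x12
  lev_pred21 (lev_pred0 k 2) (@lev_predB 2) (@lev_predM k 2) (@lev_predB 1)
  (@lev_predM k 1) lev_x00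
  lev_x01
  lev_x11
  lev_x22
  lev_x02 disc_neq0 h1 h3 h2 h4 h5 E.
by apply: entry_eq0 => -[|[|[|[|[|[|]]]]]].
Qed.

Lemma M2_reduced_ker v : reduced lev3 v -> M2 *m v = 0 -> v = 0.
Proof.
move=> hv /M2E /= [E0 E1 E2 [E3 E4 E5]].
have h j :
    lev_pred (nth 0%N [:: 0; 0; 0; 1; 0; 0; 1; 1]%N (inord j : 'I_8)) (entry v j).
  exact: hv.
have h3 := h 3%N; have h6 := h 6%N; have h7 := h 7%N.
rewrite !inordK //= in h3 h6 h7.
have [[n0 n1 n2 n3] [n4 n5 n6 n7]] := M2_reduced_inj quadratic_x12
  lev_pred21 (lev_pred0 k 2) (@lev_predM k 2) (@lev_predB 1)
  (@lev_predM k 1) lev_x00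
  lev_x01
  lev_x11
  lev_x22
  lev_x02 x00_neq0 disc_neq0
  h3 h6 h7 E0 E1 E2 E3 E4 E5.
by apply: entry_eq0 => -[|[|[|[|[|[|[|[|]]]]]]]].
Qed.

(** The first two rows form a 2 x 2 system in a and b whose determinant is nonzero, and the third
    row then gives c. *)
Lemma M3_inj (v : 'cV_3) : M3 *m v = 0 -> v = 0.
Proof.
move=> /M3E /= []; set a := entry v 0; set b := entry v 1; set c := entry v 2.
move=> E0 E1 E2.
have a0 : a = 0.
  apply: (mulf_eq0l disc_neq0).
  transitivity (x01 * (x01 * a + x00 * b) + x00 * (- x11 * a - x01 * b)).
    by clear; move: a b x00 x01 x11 => a' b' u v' w; ring.
  by rewrite E0 E1 !mulr0 addr0.
have b0 : b = 0.
  by move: E0; rewrite a0 mulr0 add0r => /(mulf_eq0l x00_neq0).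
have c0 : c = 0.
  by move: E2; rewrite a0 mulr0 add0r => /(mulf_eq0l x00_neq0).
by apply: entry_eq0 => -[|[|[|]]].
Qed.

(** Subtracting an element of the image of N makes v reduced without leaving the kernel of M, and
    there the only reduced vector is 0. *)
Lemma ker_of_reduced p q r (M : 'M[S]_(p, q)) (N : 'M[S]_(q, r)) lev :
    M *m N = 0 -> (forall v, reducible N lev v) ->
    (forall v : 'cV_q, reduced lev v -> M *m v = 0 -> v = 0) ->
  forall v : 'cV_q, M *m v = 0 -> exists w : 'cV_r, v = N *m w.
Proof.
move=> MN0 hred hker v Mv0; have [w hw] := hred v; exists w.
apply/eqP; rewrite -subr_eq0; apply/eqP/(hker _ hw).
by rewrite mulmxBr Mv0 mulmxA MN0 mul0mx subr0.
Qed.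

Lemma M1_exact (v : 'cV_6) : M1 *m v = 0 -> exists w : 'cV_8, v = M2 *m w.
Proof. exact: ker_of_reduced M1M2 M2_reducible M1_reduced_ker _. Qed.

Lemma M2_exact (v : 'cV_8) : M2 *m v = 0 -> exists w : 'cV_3, v = M3 *m w.
Proof. exact: ker_of_reduced M2M3 M3_reducible M2_reduced_ker _. Qed.

End VeroneseResolution.

(** * The Veronese map *)

Section Parity.
Context (k : fieldType) (n : nat) (chi : 'X_{1..n} -> bool).
Hypothesis chiD : forall m1 m2, chi (m1 + m2)%MM = chi m1 (+) chi m2.
Local Notation T := {mpoly k[n]}.

(** An additive [chi] is a grading of the polynomial ring by Z/2, and this describes its two
    homogeneous parts; 0 lies in both. *)
Definition has_parity (b : bool) (p : T) : Prop :=
  forall m, m \in msupp p -> chi m = b.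

Lemma has_parityD b p q : has_parity b p -> has_parity b q -> has_parity b (p + q).
Proof.
move=> hp hq m /msuppD_le; rewrite mem_cat => /orP[]; [exact: hp|exact: hq].
Qed.

Lemma has_parityN b p : has_parity b p -> has_parity b (- p).
Proof. by move=> hp m; rewrite (perm_mem (msuppN p)); exact: hp. Qed.

Lemma has_parityM b c p q :
  has_parity b p -> has_parity c q -> has_parity (b (+) c) (p * q).
Proof.
move=> hp hq m /msuppM_le /allpairsP[[m1 m2] [/= h1 h2 ->]].
by rewrite chiD (hp _ h1) (hq _ h2).
Qed.

Lemma has_parityC c : has_parity false c%:MP.
Proof.
move=> m; rewrite msuppC; case: eqP => // _; rewrite inE => /eqP ->.
by have := chiD 0%MM 0%MM; rewrite addm0; case: (chi _).
Qed.

Lemma has_parityX m : has_parity (chi m) 'X_[m].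
Proof. by move=> m'; rewrite msuppX inE => /eqP ->. Qed.

Lemma has_parity_eq0 p : has_parity true p -> has_parity false p -> p = 0.
Proof.
move=> h1 h0; apply/mpolyP => m; rewrite mcoeff0; apply/eqP/negPn/negP.
by rewrite -mcoeff_msupp => h; have := h1 m h; rewrite (h0 m h).
Qed.

Lemma parity_split p q :
  has_parity false p -> has_parity true q -> p + q = 0 -> p = 0 /\ q = 0.
Proof.
move=> hp hq /eqP; rewrite addr_eq0 => /eqP E.
have q0 : q = 0.
  by apply: has_parity_eq0 => //; rewrite -[q]opprK -E; exact: has_parityN.
by rewrite E q0 oppr0.
Qed.

End Parity.

(** * The substitution of x_i x_j for x_ij *)

Section VeroneseMap.
Context (k : fieldType).
Local Notation S := {mpoly k[6]}.
Local Notation T := {mpoly k[3]}.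
Local Notation o i := (@Ordinal 6 i isT).
Local Notation t i := (@Ordinal 3 i isT).
Local Notation X0 := ('X_(t 0) : T).
Local Notation X1 := ('X_(t 1) : T).
Local Notation X2 := ('X_(t 2) : T).

Definition veronese_mon : 'I_6 -> T :=
  tnth [tuple X0 ^+ 2; X0 * X1; X0 * X2; X1 ^+ 2; X1 * X2; X2 ^+ 2].

Definition vmap : S -> T := mmap (@mpolyC 3 k) veronese_mon.
Local Notation phi := vmap.

Lemma vmapC c : phi c%:MP = c%:MP. Proof. exact: mmapC. Qed.
Lemma vmapX i : phi 'X_i = veronese_mon i.
Proof. by rewrite /phi mmapX mmap1U. Qed.
Lemma vmapD : {morph phi : p q / p + q}. Proof. exact: mmapD. Qed.
Lemma vmapN : {morph phi : p / - p}. Proof. exact: mmapN. Qed.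
Lemma vmapM : {morph phi : p q / p * q}. Proof. exact: rmorphM. Qed.
Lemma vmap0 : phi 0 = 0. Proof. exact: mmap0. Qed.

Lemma vmap_meval h a : (phi h).@[a] = h.@[veronese a].
Proof.
elim/mpoly_ind_mulX: h => [c|p q IHp IHq|i p IHp].
- by rewrite vmapC !mevalC.
- by rewrite vmapD !mevalD IHp IHq.
- rewrite vmapM !mevalM IHp vmapX mevalXU; congr (_ * _); clear.
  by move: i; apply: ord6_ind; rewrite /= !mevalM !mevalXU.
Qed.

(** This is the restriction of [vmap] to A, once A is identified with k[x0, x1, x2] by [iota3]. *)
Definition sq : T -> T := mmap (@mpolyC 3 k) (fun i => 'X_i ^+ 2).

Lemma sqC c : sq c%:MP = c%:MP. Proof. exact: mmapC. Qed.
Lemma sqD : {morph sq : p q / p + q}. Proof. exact: mmapD. Qed.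
Lemma sqM : {morph sq : p q / p * q}. Proof. exact: rmorphM. Qed.
Lemma sqX i : sq 'X_i = 'X_i ^+ 2.
Proof. by rewrite /sq mmapX mmap1U. Qed.

Definition iota3 : T -> S :=
  mmap (@mpolyC 6 k) (tnth [tuple x00 k; x11 k; x22 k]).

Lemma iota3M : {morph iota3 : p q / p * q}. Proof. exact: rmorphM. Qed.
Lemma iota3D : {morph iota3 : p q / p + q}. Proof. exact: mmapD. Qed.
Lemma iota3C c : iota3 c%:MP = c%:MP. Proof. exact: mmapC. Qed.
Lemma iota3X i : iota3 'X_i = tnth [tuple x00 k; x11 k; x22 k] i.
Proof. by rewrite /iota3 mmapX mmap1U. Qed.

Lemma ord3_ind (P : 'I_3 -> Prop) : P (t 0) -> P (t 1) -> P (t 2) -> forall i, P i.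
Proof.
by move=> h0 h1 h2; case=> [[|[|[|i]]] lt_i] //; rewrite (bool_irrelevance lt_i isT).
Qed.

Lemma vmap_iota3 b : phi (iota3 b) = sq b.
Proof.
elim/mpoly_ind_mulX: b => [c|p q IHp IHq|i p IHp].
- by rewrite iota3C vmapC sqC.
- by rewrite iota3D vmapD IHp IHq sqD.
- rewrite iota3M vmapM IHp sqM sqX; congr (_ * _).
  by clear; move: i; apply: ord3_ind; rewrite iota3X /= vmapX.
Qed.

(** Doubling exponents is injective on monomials, so nothing is lost or merged by [sq]. *)
Lemma sq_coef b m : (sq b)@_(m + m) = b@_m.
Proof.
elim/mpolyind: b => [|c m' p _ _ IH]; first by rewrite /sq mmap0 !mcoeff0.
rewrite /sq mmapD -/(sq p) !mcoeffD IH; congr (_ + _).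
rewrite mmapZ mmapX mcoeffCM mcoeffZ mcoeffX; congr (_ * _).
have -> : mmap1 (fun i => 'X_i ^+ 2) m' = 'X_[m' + m'] :> T.
  rewrite /mmap1 mpolyXD mpolyXE_id -big_split /=; apply: eq_bigr => i _.
  by rewrite -exprM mulnC exprM expr2.
rewrite mcoeffX; congr (nat_of_bool _)%:R.
apply/eqP/eqP => [/mnmP E|-> //]; apply/mnmP => i.
by have := E i; rewrite !mnmDE !addnn => /double_inj.
Qed.

Lemma sq_eq0 b : sq b = 0 -> b = 0.
Proof. by move=> E; apply/mpolyP => m; rewrite -sq_coef E !mcoeff0. Qed.

Definition par (i : 'I_3) (m : 'X_{1..3}) : bool := odd (m i).

Lemma parD i m1 m2 : par i (m1 + m2)%MM = par i m1 (+) par i m2.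
Proof. by rewrite /par mnmDE oddD. Qed.

Lemma par_sq i b : has_parity (par i) false (sq b).
Proof.
elim/mpoly_ind_mulX: b => [c|p q IHp IHq|j p IHp].
- by rewrite sqC; apply: has_parityC; exact: parD.
- by rewrite sqD; exact: has_parityD.
- rewrite sqM sqX; apply: (has_parityM (parD i) (b := false)) => //.
  rewrite expr2 -[false](addbb (par i U_(j)%MM)).
  by apply: (has_parityM (parD i)); exact: has_parityX.
Qed.

(** The exponents of the four summands have the parities (0,0,0), (1,1,0), (1,0,1) and (0,1,1). The
    parity in x2 separates the first two from the last two, and the parity in x0 then separates the
    members of each pair. *)
Lemma sq_independent b0 b1 b2 b3 :
    sq b0 + X0 * X1 * sq b1 + X0 * X2 * sq b2 + X1 * X2 * sq b3 = 0 ->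
  [/\ b0 = 0, b1 = 0, b2 = 0 & b3 = 0].
Proof.
move=> E.
have pX i j : has_parity (par i) (j == i) ('X_j : T).
  by have := @has_parityX k _ (par i) U_(j)%MM; rewrite /par mnm1E; case: eqP.
have pXX i a b p : has_parity (par i) ((a == i) (+) (b == i)) ('X_a * 'X_b * sq p).
  rewrite -[_ (+) _]addbF; apply: (has_parityM (parD i)); last exact: par_sq.
  exact: (has_parityM (parD i)).
have [E1 E2] := parity_split
  (has_parityD (@par_sq (t 2) b0) (pXX (t 2) (t 0) (t 1) b1))
  (has_parityD (pXX (t 2) (t 0) (t 2) b2) (pXX (t 2) (t 1) (t 2) b3))
  (etrans (addrA _ _ _) E).
have [E3 E4] := parity_split (@par_sq (t 0) b0) (pXX (t 0) (t 0) (t 1) b1) E1.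
have [E5 E6] := parity_split (pXX (t 0) (t 1) (t 2) b3) (pXX (t 0) (t 0) (t 2) b2)
  (etrans (addrC _ _) E2).
have X_neq0 i : 'X_i != 0 :> T by rewrite -msize_poly_eq0 msizeX.
have XX_neq0 i j : 'X_i * 'X_j != 0 :> T by rewrite mulf_neq0.
split; first exact: sq_eq0.
- exact: sq_eq0 (mulf_eq0l (XX_neq0 _ _) E4).
- exact: sq_eq0 (mulf_eq0l (XX_neq0 _ _) E6).
- exact: sq_eq0 (mulf_eq0l (XX_neq0 _ _) E5).
Qed.

End VeroneseMap.

(** * Kernel and image of the Veronese map *)

Section VeroneseKernel.
Context (k : fieldType).
Local Notation S := {mpoly k[6]}.
Local Notation T := {mpoly k[3]}.
Local Notation o i := (@Ordinal 6 i isT).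
Local Notation t i := (@Ordinal 3 i isT).
Local Notation phi := (@vmap k).
Local Notation iota := (@iota3 k).
Local Notation x00 := (x00 k).
Local Notation x01 := (x01 k).
Local Notation x02 := (x02 k).
Local Notation x11 := (x11 k).
Local Notation x12 := (x12 k).
Local Notation x22 := (x22 k).
Local Notation M1 := (M1 k).

Lemma vmap_M1 (w : 'cV[S]_6) : phi ((M1 *m w) 0 0) = 0.
Proof.
rewrite M1E !vmapD !vmapM !vmapD !vmapN !vmapM !vmapX.
move: (phi (entry w 0)) (phi (entry w 1)) (phi (entry w 2)).
move: (phi (entry w 3)) (phi (entry w 4)) (phi (entry w 5)).
move=> n3 n4 n5 n0 n1 n2; rewrite /veronese_mon !(tnth_nth 0) /=.
move: 'X_(t 0) 'X_(t 1) 'X_(t 2) => a b c; ring.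
Qed.

(** Modulo the image of [M1], the element h is a combination of 1, x01, x02, x12 with coefficients
    in A, which enters as the image of [iota]. *)
Definition normal_form (h : S) : Prop := exists (w : 'cV[S]_6) (b0 b1 b2 b3 : T),
  h = (M1 *m w) 0 0 + (iota b0 + x01 * iota b1 + x02 * iota b2 + x12 * iota b3).

Lemma normal_formD p q : normal_form p -> normal_form q -> normal_form (p + q).
Proof.
move=> [w [b0 [b1 [b2 [b3 ->]]]]] [w' [b0' [b1' [b2' [b3' ->]]]]].
exists (w + w'), (b0 + b0'), (b1 + b1'), (b2 + b2'), (b3 + b3').
rewrite mulmxDr [in RHS]mxE !iota3D.
move: (iota b0) (iota b1) (iota b2) (iota b3) => c0 c1 c2 c3.
move: (iota b0') (iota b1') (iota b2') (iota b3') => d0 d1 d2 d3.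
move: ((M1 *m w) 0 0) ((M1 *m w') 0 0) x01 x02 x12 => u v x y z; ring.
Qed.

Lemma normal_form_iotaM c p : normal_form p -> normal_form (iota c * p).
Proof.
move=> [w [b0 [b1 [b2 [b3 ->]]]]].
exists (iota c *: w), (c * b0), (c * b1), (c * b2), (c * b3).
rewrite -scalemxAr [in RHS]mxE !iota3M.
move: (iota b0) (iota b1) (iota b2) (iota b3) => c0 c1 c2 c3.
move: ((M1 *m w) 0 0) x01 x02 x12 (iota c) => u x y z v; ring.
Qed.

Lemma iota0 : iota 0 = 0. Proof. exact: mmap0. Qed.
Lemma iota1 : iota 1 = 1. Proof. by rewrite -mpolyC1 iota3C mpolyC1. Qed.

Lemma normal_form_M1 (w : 'cV[S]_6) : normal_form ((M1 *m w) 0 0).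
Proof. by exists w, 0, 0, 0, 0; rewrite iota0 !mulr0 !addr0. Qed.

Lemma normal_form1 : normal_form 1.
Proof.
by exists 0, 1, 0, 0, 0; rewrite iota0 iota1 mulmx0 mxE !mulr0 !addr0 add0r.
Qed.

Lemma normal_form_x01 : normal_form x01.
Proof.
by exists 0, 0, 1, 0, 0; rewrite iota0 iota1 mulmx0 mxE !mulr0 !addr0 !add0r mulr1.
Qed.

Lemma normal_form_x02 : normal_form x02.
Proof.
by exists 0, 0, 0, 1, 0; rewrite iota0 iota1 mulmx0 mxE !mulr0 !addr0 !add0r mulr1.
Qed.

Lemma normal_form_x12 : normal_form x12.
Proof.
by exists 0, 0, 0, 0, 1; rewrite iota0 iota1 mulmx0 mxE !mulr0 !add0r mulr1.
Qed.

Lemma normal_form_M1_entry j : normal_form (M1 0 j).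
Proof.
have -> : M1 0 j = (M1 *m (delta_mx j 0 : 'cV_6)) 0 0 by rewrite -colE [RHS]mxE.
exact: normal_form_M1.
Qed.

Lemma normal_formN p : normal_form p -> normal_form (- p).
Proof.
move=> h; have -> : - p = iota (- 1) * p.
  by rewrite -mpolyC1 -mpolyCN iota3C mpolyCN mpolyC1 mulN1r.
exact: normal_form_iotaM.
Qed.

Let iX0 : iota 'X_(t 0) = x00. Proof. by rewrite iota3X (tnth_nth 0). Qed.
Let iX1 : iota 'X_(t 1) = x11. Proof. by rewrite iota3X (tnth_nth 0). Qed.
Let iX2 : iota 'X_(t 2) = x22. Proof. by rewrite iota3X (tnth_nth 0). Qed.

(** The minor with index j rewrites the quadratic monomial a b; the flag s is true if this monomial
    occurs in the minor with a plus sign. *)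
Let quad a b c p j (s : bool) : normal_form p ->
  a * b = iota c * p - (-1) ^+ s * M1 0 j -> normal_form (a * b).
Proof.
move=> hp ->; apply: normal_formD; first exact: normal_form_iotaM.
have := normal_form_M1_entry j; case: s => h.
  by rewrite expr1 mulN1r opprK.
by rewrite expr0 mul1r; exact: normal_formN.
Qed.

Local Ltac entry_ring := rewrite !mxE /= ?iota3M ?iX0 ?iX1 ?iX2;
  move: x00 x01 x02 x11 x12 x22 => a b c d e f; ring.

Lemma normal_form_all h : normal_form h.
Proof.
(* Each of the six minors rewrites one of the six quadratic monomials in x01, x02, x12. *)
have q11 : normal_form (x01 * x01).
  apply: (quad (c := 'X_(t 0) * 'X_(t 1)) (j := o 5) (s := false) normal_form1).
  entry_ring.
have q22 : normal_form (x02 * x02).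
  apply: (quad (c := 'X_(t 0) * 'X_(t 2)) (j := o 3) (s := false) normal_form1).
  entry_ring.
have q33 : normal_form (x12 * x12).
  apply: (quad (c := 'X_(t 1) * 'X_(t 2)) (j := o 0) (s := false) normal_form1).
  entry_ring.
have q12 : normal_form (x01 * x02).
  apply: (quad (c := 'X_(t 0)) (j := o 4) (s := false) normal_form_x12).
  entry_ring.
have q13 : normal_form (x01 * x12).
  apply: (quad (c := 'X_(t 1)) (j := o 2) (s := true) normal_form_x02).
  entry_ring.
have q23 : normal_form (x02 * x12).
  apply: (quad (c := 'X_(t 2)) (j := o 1) (s := false) normal_form_x01).
  entry_ring.
(* By linearity over A it is enough to multiply x by the four generators. *)
have mulX x : normal_form x -> normal_form (x * x01) -> normal_form (x * x02) ->
    normal_form (x * x12) -> forall p, normal_form p -> normal_form (x * p).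
  move=> h0 h1 h2 h3 p [w [b0 [b1 [b2 [b3 ->]]]]].
  have -> : x * ((M1 *m w) 0 0
      + (iota b0 + x01 * iota b1 + x02 * iota b2 + x12 * iota b3))
    = (M1 *m (x *: w)) 0 0 + (iota b0 * x + iota b1 * (x * x01)
      + iota b2 * (x * x02) + iota b3 * (x * x12)).
    rewrite -scalemxAr [in RHS]mxE.
    clear; move: (iota b0) (iota b1) (iota b2) (iota b3) => c0 c1 c2 c3.
    move: ((M1 *m w) 0 0) x01 x02 x12 => u y1 y2 y3; ring.
  apply: normal_formD; first exact: normal_form_M1.
  apply: normal_formD; last exact: normal_form_iotaM.
  apply: normal_formD; last exact: normal_form_iotaM.
  by apply: normal_formD; exact: normal_form_iotaM.
elim/mpoly_ind_mulX: h => [c|p q hp hq|i p hp].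
- rewrite -[c%:MP]mulr1 -iota3C; exact: normal_form_iotaM normal_form1.
- exact: normal_formD.
- move: i; apply: ord6_ind.
  + rewrite -/x00 -iX0; exact: normal_form_iotaM.
  + by apply: mulX => //; exact: normal_form_x01.
  + apply: mulX hp; [exact: normal_form_x02 | | exact: q22 | exact: q23].
    by rewrite mulrC.
  + rewrite -/x11 -iX1; exact: normal_form_iotaM.
  + by apply: mulX hp; [exact: normal_form_x12 | rewrite mulrC | rewrite mulrC | exact: q33].
  + rewrite -/x22 -iX2; exact: normal_form_iotaM.
Qed.

(** [vmap] kills the part of a normal form coming from [M1] and sends the rest to the sum in
    [sq_independent], which vanishes only if all coefficients do. *)
Lemma ker_vmap h : phi h = 0 -> exists w : 'cV_6, h = (M1 *m w) 0 0.
Proof.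
have [w [b0 [b1 [b2 [b3 ->]]]]] := normal_form_all h.
rewrite vmapD vmap_M1 add0r !vmapD !vmapM !vmapX !vmap_iota3.
rewrite /veronese_mon !(tnth_nth 0) /= => /sq_independent[-> -> -> ->].
by exists w; rewrite iota0 !mulr0 !addr0.
Qed.

(** This separates the terms of even degree from those of odd degree. Multiplication by a variable
    exchanges the two kinds, since x_i x_j is the image of x_ij. *)
Lemma vmap_decomp (g : T) : exists G G0 G1 G2,
  g = phi G + ('X_(t 0) * phi G0 + 'X_(t 1) * phi G1 + 'X_(t 2) * phi G2).
Proof.
elim/mpoly_ind_mulX: g => [c|p q|i p].
- by exists c%:MP, 0, 0, 0; rewrite vmapC vmap0 !mulr0 !addr0.
- move=> [G [G0 [G1 [G2 ->]]]] [H [H0 [H1 [H2 ->]]]].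
  exists (G + H), (G0 + H0), (G1 + H1), (G2 + H2); rewrite !vmapD.
  move: (phi G) (phi G0) (phi G1) (phi G2) (phi H) (phi H0) (phi H1) (phi H2).
  move=> a a0 a1 a2 b b0 b1 b2; move: 'X_(t 0) 'X_(t 1) 'X_(t 2) => x y z; ring.
- move=> [G [G0 [G1 [G2 ->]]]]; move: i; apply: ord3_ind.
  + exists (x00 * G0 + x01 * G1 + x02 * G2), G, 0, 0.
    rewrite !vmapD !vmapM vmap0 !vmapX /veronese_mon !(tnth_nth 0) /=.
    move: (phi G) (phi G0) (phi G1) (phi G2) 'X_(t 0) 'X_(t 1) 'X_(t 2).
    move=> a a0 a1 a2 x y z; ring.
  + exists (x01 * G0 + x11 * G1 + x12 * G2), 0, G, 0.
    rewrite !vmapD !vmapM vmap0 !vmapX /veronese_mon !(tnth_nth 0) /=.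
    move: (phi G) (phi G0) (phi G1) (phi G2) 'X_(t 0) 'X_(t 1) 'X_(t 2).
    move=> a a0 a1 a2 x y z; ring.
  + exists (x02 * G0 + x12 * G1 + x22 * G2), 0, 0, G.
    rewrite !vmapD !vmapM vmap0 !vmapX /veronese_mon !(tnth_nth 0) /=.
    move: (phi G) (phi G0) (phi G1) (phi G2) 'X_(t 0) 'X_(t 1) 'X_(t 2).
    move=> a a0 a1 a2 x y z; ring.
Qed.

Definition odd_mdeg (m : 'X_{1..3}) : bool := odd (mdeg m).

Lemma odd_mdegD m1 m2 : odd_mdeg (m1 + m2)%MM = odd_mdeg m1 (+) odd_mdeg m2.
Proof. by rewrite /odd_mdeg mdegD oddD. Qed.

Lemma odd_mdeg_X i : has_parity odd_mdeg true ('X_i : T).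
Proof. by have := @has_parityX k _ odd_mdeg U_(i)%MM; rewrite /odd_mdeg mdeg1. Qed.

Lemma odd_mdeg_phi h : has_parity odd_mdeg false (phi h).
Proof.
have XX i j : has_parity odd_mdeg false ('X_i * 'X_j : T).
  exact: has_parityM odd_mdegD _ _ _ _ (@odd_mdeg_X i) (@odd_mdeg_X j).
elim/mpoly_ind_mulX: h => [c|p q hp hq|i p hp].
- by rewrite vmapC; apply: has_parityC; exact: odd_mdegD.
- by rewrite vmapD; exact: has_parityD.
- rewrite vmapM; apply: (@has_parityM _ _ _ odd_mdegD false false) => //.
  rewrite vmapX; clear hp; move: i; apply: ord6_ind;
    by rewrite /veronese_mon (tnth_nth 0) /= ?expr2; exact: XX.
Qed.

(* The image of S consists of the polynomials without terms of odd degree. *)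
Lemma vmap_div (f g : T) h : has_parity odd_mdeg false f ->
  phi h = f * g -> exists G, phi h = f * phi G.
Proof.
move=> hf; have [G [G0 [G1 [G2 ->]]]] := vmap_decomp g.
rewrite mulrDr; set r := _ + _ + _ => E; exists G.
have podd i p : has_parity odd_mdeg true ('X_i * phi p).
  apply: (@has_parityM _ _ _ odd_mdegD true false); first exact: odd_mdeg_X.
  exact: odd_mdeg_phi.
(* The polynomial [f * r] is odd, [f * phi G - phi h] is even and their sum is 0, so both vanish. *)
have hr : has_parity odd_mdeg true (f * r).
  apply: (@has_parityM _ _ _ odd_mdegD false true) => //.
  by apply: has_parityD => //; exact: has_parityD.
have he : has_parity odd_mdeg false (f * phi G - phi h).
  apply: has_parityD; last by apply: has_parityN; exact: odd_mdeg_phi.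
  apply: (@has_parityM _ _ _ odd_mdegD false false) => //; exact: odd_mdeg_phi.
have [] := parity_split he hr; first by rewrite E opprD addrA subrr sub0r addNr.
by move=> /eqP; rewrite subr_eq0 => /eqP ->.
Qed.

End VeroneseKernel.

(** * The lift F of the equation f *)

Section LiftedEquation.
Context (k : fieldType) (m : nat).
Local Notation S := {mpoly k[6]}.
Local Notation T := {mpoly k[3]}.
Local Notation o i := (@Ordinal 6 i isT).
Local Notation t i := (@Ordinal 3 i isT).
Local Notation phi := (@vmap k).
Local Notation x00 := (x00 k).
Local Notation x01 := (x01 k).
Local Notation x02 := (x02 k).
Local Notation x11 := (x11 k).
Local Notation x12 := (x12 k).
Local Notation x22 := (x22 k).

(** [lifted_eq] consists of four such sums. An arbitrary target is allowed so that additive maps can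
    be moved inside. *)
Definition deg_sum (V : nmodType) (P : nat -> nat -> nat -> bool)
    (E : nat -> nat -> nat -> V) : V :=
  \sum_(i < (2 * m).+1) \sum_(j < (2 * m).+1)
    \sum_(l < (2 * m).+1 | (i + j + l == 2 * m)%N && P i j l) E i j l.

Lemma deg_sum_morph (V W : nmodType) (h : V -> W) P E :
    h 0 = 0 -> {morph h : x y / x + y} ->
  h (deg_sum P E) = deg_sum P (fun i j l => h (E i j l)).
Proof.
move=> h0 hD; rewrite /deg_sum (big_morph h hD h0); apply: eq_bigr => i _.
by rewrite (big_morph h hD h0); apply: eq_bigr => j _; rewrite (big_morph h hD h0).
Qed.

Lemma eq_deg_sum (V : nmodType) (P : nat -> nat -> nat -> bool) (E E' : nat -> nat -> nat -> V) :
    (forall i j l, (i + j + l = 2 * m)%N -> P i j l -> E i j l = E' i j l) ->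
  deg_sum P E = deg_sum P E'.
Proof.
move=> h; apply: eq_bigr => i _; apply: eq_bigr => j _; apply: eq_bigr => l.
by case/andP => /eqP; exact: h.
Qed.

(** Since i + j + l is even, either none or exactly two of the exponents are odd. *)
Lemma deg_sum_parity (V : nmodType) (E : nat -> nat -> nat -> V) :
    deg_sum (fun i j l => [&& ~~ odd i, ~~ odd j & ~~ odd l]) E
  + deg_sum (fun i j l => [&& ~~ odd i, odd j & odd l]) E
  + deg_sum (fun i j l => [&& ~~ odd j, odd i & odd l]) E
  + deg_sum (fun i j l => [&& ~~ odd l, odd i & odd j]) E
  = deg_sum (fun _ _ _ => true) E.
Proof.
rewrite /deg_sum -!big_split /=; apply: eq_bigr => i _.
rewrite -!big_split /=; apply: eq_bigr => j _.
rewrite ![\sum_(l < _ | (_ == _) && _) _]big_mkcond -!big_split /=; apply: eq_bigr => l _.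
case: eqP => [E2|_] /=; last by rewrite !addr0.
have := congr1 odd (etrans E2 (mul2n m)); rewrite odd_double !oddD.
by case: (odd i); case: (odd j); case: (odd l) => //= _; rewrite ?(addr0, add0r).
Qed.

Definition mon3 (i j l : nat) : T := 'X_(t 0) ^+ i * 'X_(t 1) ^+ j * 'X_(t 2) ^+ l.

Lemma mon3E i j l : mon3 i j l = 'X_[[multinom [tuple i; j; l]]].
Proof.
rewrite mpolyXE_id !big_ord_recl big_ord0 mulr1 /mon3 mulrA.
congr (_ ^+ _ * _ ^+ _ * _ ^+ _); rewrite ?mnmE ?(mnm_nth 0%N) //=;
  by congr 'X_(_); apply: val_inj.
Qed.

Lemma deg_sum_mon3 (f : T) : f \is (2 * m).-homog ->
  deg_sum (fun _ _ _ => true)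
    (fun i j l => f@_[multinom [tuple i; j; l]] *: mon3 i j l) = f.
Proof.
move=> hf; apply/mpolyP => n.
rewrite (deg_sum_morph (h := mcoeff n)); [|exact: mcoeff0|exact: mcoeffD].
have term i j l : (f@_[multinom [tuple i; j; l]] *: mon3 i j l)@_n
    = if (l == n (t 2)) && ((j == n (t 1)) && (i == n (t 0))) then f@_n else 0.
  rewrite mcoeffZ mon3E mcoeffX.
  have -> : ([multinom [tuple i; j; l]] == n)
      = ((l == n (t 2)) && ((j == n (t 1)) && (i == n (t 0)))).
    apply/eqP/and3P => [<-|[/eqP -> /eqP -> /eqP ->]].
      by rewrite !(mnm_nth 0%N) /= !eqxx.
    by apply/mnmP; apply: ord3_ind; rewrite !(mnm_nth 0%N).
  case: ifP => [/and3P[/eqP-> /eqP-> /eqP->]|_]; last by rewrite mulr0.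
  rewrite mulr1; congr (f@_ _); apply/mnmP; apply: ord3_ind; by rewrite !(mnm_nth 0%N).
have dn : mdeg n = (n (t 0) + n (t 1) + n (t 2))%N.
  rewrite mdegE !big_ord_recl big_ord0 addn0 addnA.
  by congr (n _ + n _ + n _)%N; apply: val_inj.
have [E|ne] := eqVneq (mdeg n) (2 * m)%N; last first.
  rewrite [RHS](dhomog_nemf_coeff hf ne) /deg_sum.
  rewrite big1 // => i _; rewrite big1 // => j _; rewrite big1 // => l _.
  by rewrite term (dhomog_nemf_coeff hf ne) if_same.
have lt_n i : (n i < (2 * m).+1)%N.
  by rewrite ltnS -E mdegE (bigD1 i) //= leq_addr.
(* Only the triple of exponents of n contributes; the three sums are cut down to it one after the
   other. *)
rewrite /deg_sum (bigD1 (Ordinal (lt_n (t 0)))) //= [X in _ + X]big1 => [|i nei].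
  rewrite addr0 (bigD1 (Ordinal (lt_n (t 1)))) //= [X in _ + X]big1 => [|j nej].
    rewrite addr0 (bigD1 (Ordinal (lt_n (t 2)))) /=; last by rewrite -dn E eqxx.
    rewrite big1 => [|l /andP[_ nel]]; first by rewrite addr0 term !eqxx.
    by rewrite term -[l == _ :> nat]/(l == Ordinal (lt_n (t 2))) (negPf nel).
  rewrite big1 // => l _.
  by rewrite term -[j == _ :> nat]/(j == Ordinal (lt_n (t 1))) (negPf nej) andbF.
rewrite big1 // => j _; rewrite big1 // => l _.
by rewrite term -[i == _ :> nat]/(i == Ordinal (lt_n (t 0))) (negPf nei) !andbF.
Qed.

Lemma vmapZ c (p : S) : phi (c *: p) = c *: phi p.
Proof. by rewrite -!mul_mpolyC vmapM vmapC. Qed.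

Lemma vmapXn (p : S) n : phi (p ^+ n) = phi p ^+ n.
Proof. exact: rmorphXn. Qed.

Lemma vmap_even_power (p : S) (q : T) i : phi p = q ^+ 2 -> ~~ odd i ->
  phi (p ^+ i./2) = q ^+ i.
Proof. by move=> pq ei; rewrite vmapXn pq -exprM mul2n even_halfK. Qed.

Lemma vmap_odd_power (p : S) (q : T) i : phi p = q ^+ 2 -> odd i ->
  phi (p ^+ i.-1./2) * q = q ^+ i.
Proof.
by case: i => // i pq ei; rewrite (vmap_even_power pq) // exprSr.
Qed.

Lemma lifted_eqE (f : T) : let a i j l := f@_[multinom [tuple i; j; l]] in
  lifted_eq m f =
    deg_sum (fun i j l => [&& ~~ odd i, ~~ odd j & ~~ odd l])
      (fun i j l => a i j l *: (x00 ^+ i./2 * x11 ^+ j./2 * x22 ^+ l./2))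
  + deg_sum (fun i j l => [&& ~~ odd i, odd j & odd l])
      (fun i j l => a i j l *: (x00 ^+ i./2 * x11 ^+ j.-1./2 * x22 ^+ l.-1./2 * x12))
  + deg_sum (fun i j l => [&& ~~ odd j, odd i & odd l])
      (fun i j l => a i j l *: (x00 ^+ i.-1./2 * x11 ^+ j./2 * x22 ^+ l.-1./2 * x02))
  + deg_sum (fun i j l => [&& ~~ odd l, odd i & odd j])
      (fun i j l => a i j l *: (x00 ^+ i.-1./2 * x11 ^+ j.-1./2 * x22 ^+ l./2 * x01)).
Proof. by []. Qed.

Lemma vmap_lifted_eq (f : T) : f \is (2 * m).-homog -> phi (lifted_eq m f) = f.
Proof.
move=> hf; rewrite -[RHS](deg_sum_mon3 hf) -deg_sum_parity lifted_eqE /= !vmapD.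
have p00 : phi x00 = 'X_(t 0) ^+ 2 by rewrite vmapX.
have p11 : phi x11 = 'X_(t 1) ^+ 2 by rewrite vmapX.
have p22 : phi x22 = 'X_(t 2) ^+ 2 by rewrite vmapX.
have p01 : phi x01 = 'X_(t 0) * 'X_(t 1) by rewrite vmapX.
have p02 : phi x02 = 'X_(t 0) * 'X_(t 2) by rewrite vmapX.
have p12 : phi x12 = 'X_(t 1) * 'X_(t 2) by rewrite vmapX.
congr (_ + _ + _ + _); rewrite (deg_sum_morph _ _ (vmap0 k) (@vmapD k));
  apply: eq_deg_sum => i j l _ /and3P[hi hj hl]; rewrite vmapZ !vmapM /mon3; congr (_ *: _).
- by rewrite (vmap_even_power p00) // (vmap_even_power p11) // (vmap_even_power p22).
- rewrite p12 (vmap_even_power p00) // -(vmap_odd_power p11 hj) -(vmap_odd_power p22 hl).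
  move: (phi _) (phi _) ('X_(t 0) ^+ i) 'X_(t 1) 'X_(t 2) => a b c x y; ring.
- rewrite p02 (vmap_even_power p11) // -(vmap_odd_power p00 hj) -(vmap_odd_power p22 hl).
  move: (phi _) (phi _) ('X_(t 1) ^+ j) 'X_(t 0) 'X_(t 2) => a b c x y; ring.
- rewrite p01 (vmap_even_power p22) // -(vmap_odd_power p00 hj) -(vmap_odd_power p11 hl).
  move: (phi _) (phi _) ('X_(t 2) ^+ l) 'X_(t 0) 'X_(t 1) => a b c x y; ring.
Qed.

Lemma lifted_eq_homog (f : T) : lifted_eq m f \is m.-homog.
Proof.
have hX i : ('X_i : S) \is 1.-homog by rewrite dhomogX /= mdeg1.
have hXn i d : ('X_i ^+ d : S) \is d.-homog.
  by have := dhomogMn d (hX i); rewrite mul1n.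
have h3 a b c : (x00 ^+ a * x11 ^+ b * x22 ^+ c) \is (a + b + c).-homog.
  by apply: dhomogM; [apply: dhomogM|]; exact: hXn.
have h4 a b c i d : (a + b + c).+1 = d ->
    (x00 ^+ a * x11 ^+ b * x22 ^+ c * 'X_i) \is d.-homog.
  by move=> <-; rewrite -[X in X.-homog]addn1; apply: dhomogM; [exact: h3 | exact: hX].
have hsum (P : nat -> nat -> nat -> bool) (E : nat -> nat -> nat -> S) :
    (forall i j l, (i + j + l = 2 * m)%N -> P i j l -> E i j l \is m.-homog) ->
  deg_sum P E \is m.-homog.
  move=> h; apply: rpred_sum => i _; apply: rpred_sum => j _.
  by apply: rpred_sum => l /andP[/eqP]; exact: h.
rewrite lifted_eqE /=.
apply: rpredD; first apply: rpredD; first apply: rpredD;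
  apply: hsum => i j l e /and3P[hi hj hl]; apply: rpredZ.
- have := h3 i./2 j./2 l./2; congr (_ \is _.-homog); lia.
- apply: h4; lia.
- apply: h4; lia.
- apply: h4; lia.
Qed.

End LiftedEquation.

(** For forms, this makes vanishing at a projective point independent of the coordinate vector
    chosen. *)
Lemma dhomog_meval_scale (R : comNzRingType) n d (p : {mpoly R[n]}) c v w :
    p \is d.-homog -> (forall i, w i = c * v i) ->
  p.@[w] = c ^+ d * p.@[v].
Proof.
move=> /dhomogP hp hw; rewrite !mevalE mulr_sumr.
rewrite big_seq [RHS]big_seq; apply: eq_bigr => m' /hp <-.
rewrite mulrCA; congr (_ * _); rewrite /= mdegE.
rewrite (big_morph (fun e => c ^+ e) (exprD c) (expr0 c)) -big_split /=.
by apply: eq_bigr => i _; rewrite hw exprMn.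
Qed.

(** * Factoriality of polynomial rings *)

Section Divisibility.
Context (R : idomainType).
Implicit Types a b c p : R.

Definition divides a b : Prop := exists c, b = a * c.

Definition prime_elt p : Prop :=
  [/\ p != 0, p \isn't a GRing.unit &
      forall a b, divides p (a * b) -> divides p a \/ divides p b].

Definition factorial_elt a : Prop := exists (u : R) (s : seq R),
  [/\ u \is a GRing.unit, forall p, p \in s -> prime_elt p & a = u * \prod_(p <- s) p].

Lemma divides_mulr a b c : divides a b -> divides a (b * c).
Proof. by move=> [d ->]; exists (d * c); rewrite mulrA. Qed.

Lemma divides_mull a b c : divides a b -> divides a (c * b).
Proof. by rewrite mulrC; exact: divides_mulr. Qed.

Lemma dividesD a b c : divides a b -> divides a c -> divides a (b + c).
Proof. by move=> [d ->] [e ->]; exists (d + e); rewrite mulrDr. Qed.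

Lemma divides0 a : divides a 0.
Proof. by exists 0; rewrite mulr0. Qed.

Lemma divides_trans a b c : divides a b -> divides b c -> divides a c.
Proof. by move=> [d ->] [e ->]; exists (d * e); rewrite mulrA. Qed.

Lemma prime_elt_unitM p u : u \is a GRing.unit -> prime_elt p -> prime_elt (p * u).
Proof.
move=> uu [p0 pu pp]; split.
- by rewrite mulf_neq0 //; apply: contraTneq uu => ->; rewrite unitr0.
- by rewrite unitrM negb_and pu.
- have pd : divides (p * u) p by exists u^-1; rewrite mulrK.
  move=> a b [c E]; have /pp [] : divides p (a * b).
  + by exists (u * c); rewrite E mulrA.
  + by left; exact: divides_trans pd _.
  + by right; exact: divides_trans pd _.
Qed.

Lemma prime_divides_unit p u : prime_elt p -> u \is a GRing.unit -> ~ divides p u.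
Proof. by move=> [_ pu _] uu [c E]; move: uu pu; rewrite E unitrM => /andP[->]. Qed.

Lemma prime_divides_prod p (s : seq R) : prime_elt p ->
  divides p (\prod_(q <- s) q) -> exists2 q, q \in s & divides p q.
Proof.
move=> pp; elim: s => [|q s IH].
  by rewrite big_nil => /(prime_divides_unit pp (unitr1 R)).
rewrite big_cons; case: (pp) => _ _ h /h [dq|/IH [r rs dr]].
  by exists q; rewrite ?inE ?eqxx.
by exists r; rewrite ?inE ?rs ?orbT.
Qed.

(** Write q = p c. The prime q divides p or c: in the first case c is a unit, in the second p would
    be one. *)
Lemma prime_divides_prime p q : prime_elt p -> prime_elt q -> divides p q ->
  exists2 u, u \is a GRing.unit & q = p * u.
Proof.
move=> [p0 pu _] [q0 qu qq] [c E]; exists c => //.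
have [|[d Ed]|[d Ed]] := qq p c; first by exists 1; rewrite E mulr1.
- apply/unitrP; exists d; suff E1 : c * d = 1 by rewrite mulrC.
  by apply: (mulfI p0); rewrite mulr1 mulrA -E -Ed.
- case/negP: pu; apply/unitrP; exists d; suff E1 : p * d = 1 by rewrite mulrC.
  by apply: (mulfI q0); rewrite mulr1 mulrCA -Ed -E.
Qed.

Lemma factorial_unit u : u \is a GRing.unit -> factorial_elt u.
Proof. by exists u, [::]; rewrite big_nil mulr1. Qed.

Lemma factorial_prime p : prime_elt p -> factorial_elt p.
Proof.
exists 1, [:: p]; rewrite big_seq1 mul1r; split; rewrite ?unitr1 //.
by move=> q; rewrite inE => /eqP ->.
Qed.

Lemma factorialM a b : factorial_elt a -> factorial_elt b -> factorial_elt (a * b).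
Proof.
move=> [u [s [uu hs ->]]] [v [r [vu hr ->]]]; exists (u * v), (s ++ r).
rewrite unitrM uu vu big_cat /= mulrACA; split=> // p.
by rewrite mem_cat => /orP[]; [exact: hs | exact: hr].
Qed.

Lemma factorial_nonunit a : factorial_elt a -> a \isn't a GRing.unit ->
  exists p b, prime_elt p /\ a = p * b.
Proof.
move=> [u [[|p s] [uu hs ->]]]; first by rewrite big_nil mulr1 uu.
move=> _; exists p, (u * \prod_(q <- s) q).
by rewrite big_cons mulrCA; split=> //; apply: hs; rewrite inE eqxx.
Qed.

(** As the factors are prime and not just irreducible, the existence of factorizations entails their
    uniqueness. *)
Definition ufd : Prop := forall a, a != 0 -> factorial_elt a.

(** A prime factor of p leaves a cofactor that is a unit by irreducibility, so p is associated to a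
    prime. *)
Lemma ufd_irreducible_prime p : ufd -> irreducible_elt p -> prime_elt p.
Proof.
move=> hR [p0 pu pirr].
have [q [b [qp E]]] := factorial_nonunit (hR p p0) pu.
case: (pirr _ _ E) => [qu|bu]; first by case: qp => _ /negP.
by rewrite E; exact: prime_elt_unitM.
Qed.

End Divisibility.

(** * Gauss's lemma *)

Section Gauss.
Context (R : idomainType) (R_ufd : ufd R).
Implicit Types (p c : R) (f g h q : {poly R}).

Lemma divides_polyC c g : (forall i, divides c g`_i) -> divides c%:P g.
Proof.
move=> /boolp.choice [q hq]; exists (\poly_(i < size g) q i).
apply/polyP => i; rewrite coefCM coef_poly hq.
by case: ltnP => // le_g; rewrite mulr0 -hq nth_default.
Qed.

Lemma divides_polyC_coef c g i : divides c%:P g -> divides c g`_i.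
Proof. by move=> [q ->]; exists q`_i; rewrite coefCM. Qed.

(** The prime p divides one of the two leading coefficients. Removing that leading term lowers the
    size and keeps the product divisible by p, which allows induction. *)
Lemma prime_polyC p : prime_elt p -> prime_elt p%:P.
Proof.
move=> [p0 pu pp]; split; first by rewrite polyC_eq0.
  by rewrite poly_unitE coefC eqxx (negPf pu) andbF.
move=> f g; have [n] := ubnP (size f + size g)%N.
elim: n f g => // n IH f g; rewrite ltnS => le_n d.
have key (a b : {poly R}) : (size a + size b <= n)%N -> a != 0 ->
    divides p (lead_coef a) -> divides p%:P (a * b) ->
    divides p%:P a \/ divides p%:P b.
  move=> le_ab a0 [l El] dab; pose a' := \poly_(i < (size a).-1) a`_i.
  pose t := (p * l) *: 'X^((size a).-1).
  have sa : size a = (size a).-1.+1 by rewrite prednK // size_poly_gt0.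
  have aE : a = a' + t.
    rewrite /t -El lead_coefE -{1}[a]coefK {1}sa poly_def big_ord_recr /=.
    by rewrite -poly_def.
  have dt : divides p%:P t.
    by exists (l *: 'X^((size a).-1)); rewrite mul_polyC scalerA.
  have : divides p%:P (a' * b).
    have -> : a' * b = a * b + (- b) * t by rewrite aE; ring.
    by apply: dividesD => //; exact: divides_mull.
  move=> /IH [|da'|db]; last by right.
    by apply: leq_trans le_ab; rewrite sa addSn ltnS leq_add2r size_poly.
  by left; rewrite aE; exact: dividesD.
have [->|f0] := eqVneq f 0; first by left; exact: divides0.
have [->|g0] := eqVneq g 0; first by right; exact: divides0.
have /pp [df|dg] : divides p (lead_coef f * lead_coef g).
  by rewrite -lead_coefM; exact: divides_polyC_coef.
- exact: key.
- by case: (key g f); rewrite 1?addnC 1?[g * f]mulrC //; auto.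
Qed.

(** The prime factors of c are cancelled one by one, each against one of the two factors. This turns
    a factorization over the fraction field into one over R with the same degrees. *)
Lemma cancel_constants c f d q : c != 0 -> c%:P * f = d * q ->
  exists d' q', [/\ f = d' * q', size d' = size d & size q' = size q].
Proof.
move=> c0; have [u [s [uu hs cE]]] := R_ufd c0.
elim: s c c0 hs cE f d q => [|p s IH] c c0 hs cE f d q E.
  exists (u^-1%:P * d), q; split=> //; last first.
    by rewrite mul_polyC size_scale // invr_eq0; apply: contraTneq uu => ->; rewrite unitr0.
  by rewrite -mulrA -E cE big_nil mulr1 mulrA -polyCM mulVr // mul1r.
have pp : prime_elt p by apply: hs; rewrite inE eqxx.
have pP := prime_polyC pp; have [p0 _ _] := pp.
pose c' := u * \prod_(q <- s) q.
have cE' : c = p * c' by rewrite cE big_cons mulrCA.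
have c'0 : c' != 0 by move: c0; rewrite cE' mulf_eq0 negb_or => /andP[].
have hs' r : r \in s -> prime_elt r by move=> rs; apply: hs; rewrite inE rs orbT.
have : divides p%:P (d * q).
  by exists (c'%:P * f); rewrite -E cE' polyCM mulrA.
have pC0 : p%:P != 0 by rewrite polyC_eq0.
case: pP => _ _ pP /pP [[d1 Ed]|[q1 Eq]].
- have [|d' [q' [Ef sd sq]]] := IH _ c'0 hs' erefl f d1 q.
    by apply: (mulfI pC0); rewrite !mulrA -polyCM -cE' E Ed.
  by exists d', q'; split=> //; rewrite Ed mul_polyC size_scale.
- have [|d' [q' [Ef sd sq]]] := IH _ c'0 hs' erefl f d q1.
    by apply: (mulfI pC0); rewrite !mulrA -polyCM -cE' E Eq mulrCA mulrA.
  by exists d', q'; split=> //; rewrite Eq mul_polyC size_scale.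
Qed.

(** A prime factor of c cannot divide f, for its cofactor would be a unit and f a constant. It
    therefore divides the quotient and can be cancelled. *)
Lemma divides_constM c f g : irreducible_elt f -> (1 < size f)%N -> c != 0 ->
  divides f (c%:P * g) -> divides f g.
Proof.
move=> [f0 fu firr] sf c0; have [u [s [uu hs cE]]] := R_ufd c0.
elim: s c c0 hs cE g => [|p s IH] c c0 hs cE g [q E].
  exists (u^-1%:P * q); rewrite mulrCA -E cE big_nil mulr1 mulrA -polyCM.
  by rewrite mulVr // mul1r.
have pp : prime_elt p by apply: hs; rewrite inE eqxx.
have [pC0 pCu pP] := prime_polyC pp.
pose c' := u * \prod_(q <- s) q.
have cE' : c = p * c' by rewrite cE big_cons mulrCA.
have c'0 : c' != 0 by move: c0; rewrite cE' mulf_eq0 negb_or => /andP[].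
have hs' r : r \in s -> prime_elt r by move=> rs; apply: hs; rewrite inE rs orbT.
have /pP [[f1 Ef]|[q1 Eq]] : divides p%:P (f * q).
  by exists (c'%:P * g); rewrite -E cE' polyCM mulrA.
  case: (firr _ _ Ef) => [pu|f1u]; first by rewrite pu in pCu.
  have p0 : p != 0 by case: pp.
  move: sf; rewrite Ef mul_polyC size_scale //.
  by move: f1u; rewrite poly_unitE => /andP[/eqP ->].
apply: (IH _ c'0 hs' erefl); exists q1.
by apply: (mulfI pC0); rewrite [LHS]mulrA -polyCM -cE' E Eq mulrCA.
Qed.

(** Coprimality refers to the fraction field. The gcd divides f up to a constant, so f factors over
    R with one factor of the size of the gcd. If that factor is a unit, the gcd is constant; if the
    other one is, f divides a constant multiple of g and hence g. *)
Lemma irreducible_coprimep f g : irreducible_elt f -> (1 < size f)%N ->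
  ~ divides f g -> coprimep f g.
Proof.
move=> firr sf fg; case: (firr) => f0 _ hirr; rewrite coprimep_def; apply/eqP.
have /Pdiv.Idomain.dvdpP [[c q] /= c0 Ec] := dvdp_gcdl f g.
have /Pdiv.Idomain.dvdpP [[b r] /= b0 Eb] := dvdp_gcdr f g.
move: (gcdp f g) Ec Eb => d; rewrite -!mul_polyC => Ec Eb.
have [q' [d' [Ef sq <-]]] := cancel_constants c0 Ec.
case: (hirr _ _ Ef) => [|]; last by rewrite poly_unitE => /andP[/eqP ->].
rewrite poly_unitE sq => /andP[/size_poly1P[e e0 qE] _]; case: fg.
apply: (divides_constM firr sf (mulf_neq0 e0 b0)); exists (c%:P * r).
by rewrite polyCM -mulrA Eb mulrCA [RHS]mulrA [f * _]mulrC Ec qE; ring.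
Qed.

(** Euclid's lemma over the fraction field gives f as a divisor of a constant multiple of h, and
    [divides_constM] removes the constant. *)
Lemma irreducible_prime_poly f : irreducible_elt f -> (1 < size f)%N -> prime_elt f.
Proof.
move=> firr sf; case: (firr) => f0 fu _; split=> // g h [q E].
have [|ndg] := pselect (divides f g); first by left.
right; have cop := irreducible_coprimep firr sf ndg.
have : f %| h by rewrite -(Gauss_dvdpr h cop) E dvdp_mulr.
move=> /Pdiv.Idomain.dvdpP [[c r] /= c0 Ec].
apply: (divides_constM firr sf c0); exists r.
by rewrite mul_polyC Ec mulrC.
Qed.

Lemma factorial_polyC c : c != 0 -> factorial_elt c%:P.
Proof.
move=> /R_ufd [u [s [uu hs ->]]]; exists u%:P, [seq p%:P | p <- s]; split.
- by rewrite poly_unitE coefC eqxx uu size_polyC (memPn _ _ uu) // unitr0.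
- by move=> _ /mapP [p ps ->]; apply: prime_polyC; exact: hs.
- by rewrite polyCM big_map rmorph_prod.
Qed.

(** Induction on the size of f and, for bounded size, on the number of prime factors of the leading
    coefficient. A product of two factors of positive degree lowers the size; a nonunit constant
    factor contains a prime that can be removed from the leading coefficient. *)
Lemma ufd_poly : ufd {poly R}.
Proof.
move=> f; have [n] := ubnP (size f); elim: n f => // n IHn f; rewrite ltnS => le_f f0.
have lf0 : lead_coef f != 0 by rewrite lead_coef_eq0.
have [u [s [uu hs El]]] := R_ufd lf0.
have [N] := ubnP (size s); elim: N f s u le_f f0 lf0 uu hs El => // N IHN f s u.
rewrite ltnS => le_f f0 lf0 uu hs El le_s.
have [/eqP/size_poly1P [c c0 ->]|sf] := eqVneq (size f) 1%N.
  exact: factorial_polyC.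
have {}sf : (1 < size f)%N.
  by rewrite ltn_neqAle eq_sym sf size_poly_gt0.
have [/irreducible_prime_poly/(_ sf)/factorial_prime //|nirr] :=
  pselect (irreducible_elt f).
have fu : f \isn't a GRing.unit by rewrite poly_unitE gtn_eqF.
have [q [r [Ef qu ru]]] : exists q r,
    [/\ f = q * r, q \isn't a GRing.unit & r \isn't a GRing.unit].
  apply: contrapT => no; apply: nirr; split=> // q r Ef.
  apply: contrapT => /not_orP [/negP qu /negP ru]; apply: no.
  by exists q, r.
move: f0; rewrite Ef mulf_eq0 negb_or => /andP[q0 r0].
have key c g : f = c%:P * g -> c \isn't a GRing.unit -> factorial_elt f.
  move=> Eg cu.
  have c0 : c != 0 by apply: contraTneq lf0 => c0; rewrite Eg c0 mul0r lead_coef0 eqxx.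
  have [p [c' [pp Ec]]] := factorial_nonunit (R_ufd c0) cu.
  have [p0 _ pP] := pp.
  pose f' := c'%:P * g; have Ef' : f = p%:P * f' by rewrite Eg Ec polyCM mulrA.
  have lE : lead_coef f = p * lead_coef f' by rewrite Ef' lead_coefM lead_coefC.
  rewrite Ef'; apply: factorialM; first exact/factorial_prime/prime_polyC.
  have : divides p (u * \prod_(q <- s) q) by exists (lead_coef f'); rewrite -El.
  move=> /pP [/(prime_divides_unit pp uu) //|/(prime_divides_prod pp) [t ts dt]].
  (* The prime p is associated to some t in the list s; dropping t shortens the list, and the unit v
     joins u. *)
  have [v vu Et] := prime_divides_prime pp (hs t ts) dt.
  have sf' : size f' = size f by rewrite Ef' mul_polyC size_scale.
  have f'0 : f' != 0 by rewrite -size_poly_gt0 sf' (ltnW sf).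
  apply: (IHN f' (rem t s) (u * v)) => //.
  - by rewrite sf'.
  - by rewrite lead_coef_eq0.
  - by rewrite unitrM uu vu.
  - by move=> x /mem_rem; exact: hs.
  - apply: (mulfI p0); rewrite -lE El (big_rem t ts) /= Et; ring.
  - by rewrite size_rem // prednK //; case: (s) ts.
have szE : size f = (size q + size r).-1 by rewrite Ef size_mul.
have [sr|sr] := eqVneq (size r) 1%N.
  have /eqP/size_poly1P [c c0 Er] := sr.
  rewrite -Ef; apply: (key c q); first by rewrite Ef Er mulrC.
  by apply: contra ru; rewrite poly_unitE sr Er coefC /=.
have [sq|sq] := eqVneq (size q) 1%N.
  have /eqP/size_poly1P [c c0 Eq] := sq.
  rewrite -Ef; apply: (key c r); first by rewrite Ef Eq.
  by apply: contra qu; rewrite poly_unitE sq Eq coefC /=.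
have q_gt0 : (0 < size q)%N by rewrite size_poly_gt0.
have r_gt0 : (0 < size r)%N by rewrite size_poly_gt0.
by apply: factorialM; apply: IHn => //; move: le_f; rewrite szE;
  clear -sq sr q_gt0 r_gt0; lia.
Qed.

End Gauss.

(** * Nullstellensatz for hypersurfaces *)

Section ClosedFieldPoints.
Context (k : closedFieldType).

(** If p vanished everywhere, p + 1 would have no root and so be constant; then p would be a
    constant with value 0. *)
Lemma closed_field_nonroot (p : {poly k}) : p != 0 -> exists t, p.[t] != 0.
Proof.
move=> p0.
apply: contrapT => no.
have h t : p.[t] = 0.
  by apply/eqP/negPn/negP => pt; apply: no; exists t.
have : size (p + 1) == 1%N.
  apply/negPn/negP => /closed_rootP [t].
  by rewrite /root hornerD h hornerC add0r oner_eq0.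
move=> /size_poly1P [c c0 E].
have pE : p = (c - 1)%:P by rewrite polyCB -E addrK.
by move: p0 (h 0); rewrite pE hornerC polyC_eq0 => /eqP.
Qed.

(* D plays the role of the coordinate ring of an affine space with set of points P. *)
Definition affine_nullstellensatz (D : idomainType) (P : Type)
    (ev : P -> {rmorphism D -> k}) : Prop :=
  [/\ ufd D, forall d, d != 0 -> exists v, ev v d != 0 &
      forall f g, irreducible_elt f -> (forall v, ev v f = 0 -> ev v g = 0) ->
      divides f g].

Section Step.
Context (D : idomainType) (P : Type) (ev : P -> {rmorphism D -> k}).
Hypothesis null_D : affine_nullstellensatz ev.

(** Over a point v where c vanishes, g vanishes for every t. All coefficients of g thus vanish
    wherever c does, and are divisible by c. *)
Lemma null_poly_const (c : D) (g : {poly D}) : irreducible_elt c%:P ->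
    (forall v t, (map_poly (ev v) c%:P).[t] = 0 -> (map_poly (ev v) g).[t] = 0) ->
  divides c%:P g.
Proof.
case: null_D => D_ufd nz nul [c0 cu cirr] van.
have cP : irreducible_elt c.
  split.
  - by move: c0; rewrite polyC_eq0.
  - by apply: contra cu => cu'; rewrite poly_unitE coefC eqxx cu' andbT
      size_polyC; move: c0; rewrite polyC_eq0 => ->.
  - move=> a b E; case: (cirr a%:P b%:P); first by rewrite E polyCM.
      by rewrite poly_unitE coefC => /andP[_]; left.
    by rewrite poly_unitE coefC => /andP[_]; right.
apply: divides_polyC => i; apply: nul => // v vc.
have -> : ev v g`_i = (map_poly (ev v) g)`_i by rewrite coef_map.
suff -> : map_poly (ev v) g = 0 by rewrite coef0.
apply/eqP/negPn/negP => /closed_field_nonroot [t] /eqP; apply.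
by apply: van; rewrite map_polyC hornerC.
Qed.

(** For positive degrees this is the resultant, nonzero by coprimality; a constant g is its own
    eliminant. *)
Lemma eliminant (f g : {poly D}) : (1 < size f)%N -> g != 0 -> coprimep f g ->
  exists r (u v : {poly D}), r != 0 /\ r%:P = u * f + v * g.
Proof.
move=> sf g0 cop; have [sg|sg] := leqP (size g) 1.
  have /size_poly1P [b b0 ->] : size g == 1%N.
    by rewrite eqn_leq sg size_poly_gt0.
  by exists b, 0, 1; rewrite mul0r add0r mul1r.
have [[u v] /= _ E] := resultant_in_ideal sf sg.
exists (resultant f g), u, v; split=> //.
by rewrite resultant_eq0 (eqP cop).
Qed.

(** If f did not divide g, they would have a nonzero eliminant r. Over a point v where neither r nor
    the leading coefficient of f vanishes, f keeps its positive degree and has a root; g vanishes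
    there too, which forces r to vanish at v. *)
Lemma null_poly (f g : {poly D}) : irreducible_elt f ->
    (forall v t, (map_poly (ev v) f).[t] = 0 -> (map_poly (ev v) g).[t] = 0) ->
  divides f g.
Proof.
move=> firr van; case: (firr) => f0 _ _.
have [/eqP/size_poly1P [c c0 fE]|sf1] := eqVneq (size f) 1%N.
  by rewrite fE in firr van *; exact: null_poly_const.
have sf : (1 < size f)%N by rewrite ltn_neqAle eq_sym sf1 size_poly_gt0.
apply: contrapT => nfg; case: null_D => D_ufd nz _.
have g0 : g != 0 by apply/eqP => g0; apply: nfg; rewrite g0; exact: divides0.
have [r [u [w [r0 E]]]] := eliminant sf g0 (irreducible_coprimep D_ufd firr sf nfg).
have lf0 : lead_coef f != 0 by rewrite lead_coef_eq0.
have [v] := nz (r * lead_coef f) (mulf_neq0 r0 lf0).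
rewrite rmorphM mulf_eq0 negb_or => /andP[vr vf].
have /closed_rootP [t /rootP ft] : size (map_poly (ev v) f) != 1%N.
  by rewrite size_map_poly_id0.
have := congr1 (fun p => (map_poly (ev v) p).[t]) E.
rewrite map_polyC rmorphD !rmorphM /= hornerC hornerD !hornerM ft (van _ _ ft).
by rewrite !mulr0 addr0 => /eqP; rewrite (negPf vr).
Qed.

Lemma nonzero_poly_point (f : {poly D}) : f != 0 ->
  exists v t, (map_poly (ev v) f).[t] != 0.
Proof.
move=> f0; case: null_D => _ nz _.
have [v vf] : exists v, ev v (lead_coef f) != 0.
  by apply: nz; rewrite lead_coef_eq0.
have /closed_field_nonroot [t ft] : map_poly (ev v) f != 0.
  by rewrite -size_poly_eq0 size_map_poly_id0 // size_poly_eq0.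
by exists v, t.
Qed.

End Step.

End ClosedFieldPoints.

(** * Transport of divisibility along ring isomorphisms *)

Section Iso.
Context (A B : idomainType) (al : {rmorphism A -> B}) (be : B -> A).
Hypotheses (alK : cancel al be) (beK : cancel be al).

Lemma iso_unit a : (al a \is a GRing.unit) = (a \is a GRing.unit).
Proof.
apply/idP/idP => [/unitrP [b [ba ab]]|]; last exact: rmorph_unit.
apply/unitrP; exists (be b).
by split; apply: (can_inj alK); rewrite rmorphM beK rmorph1.
Qed.

Lemma iso_divides a b : divides (al a) (al b) -> divides a b.
Proof.
by move=> [c E]; exists (be c); apply: (can_inj alK); rewrite rmorphM beK.
Qed.

Lemma iso_divides_inv a b : divides a b -> divides (al a) (al b).
Proof. by move=> [c ->]; exists (al c); rewrite rmorphM. Qed.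

Lemma iso_neq0 a : (al a != 0) = (a != 0).
Proof. by rewrite -(rmorph0 al) (inj_eq (can_inj alK)). Qed.

Lemma iso_irreducible a : irreducible_elt a -> irreducible_elt (al a).
Proof.
move=> [a0 au airr]; split; rewrite ?iso_neq0 ?iso_unit // => q r E.
rewrite -(beK q) -(beK r) !iso_unit; apply: airr.
by apply: (can_inj alK); rewrite rmorphM !beK.
Qed.

Lemma iso_prime b : prime_elt b -> prime_elt (be b).
Proof.
move=> [b0 bu bp]; split; rewrite -?iso_neq0 -?iso_unit ?beK //.
move=> x y /iso_divides_inv; rewrite rmorphM beK => /bp.
by case=> h; [left|right]; apply: iso_divides; rewrite beK.
Qed.

Lemma iso_ufd : ufd B -> ufd A.
Proof.
move=> hB a; rewrite -iso_neq0 => /hB [u [s [uu hs E]]].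
exists (be u), [seq be p | p <- s]; split.
- by rewrite -iso_unit beK.
- by move=> _ /mapP [p ps ->]; apply: iso_prime; exact: hs.
- apply: (can_inj alK); rewrite E rmorphM beK; congr (_ * _).
  rewrite big_map rmorph_prod; apply: eq_bigr => p _.
  by rewrite beK.
Qed.

End Iso.

(** * Splitting off the last variable *)

Section MpolyPoly.
Context (R : comNzRingType) (n : nat).
Local Notation A := {mpoly R[n.+1]}.
Local Notation B := {mpoly R[n]}.

Definition uni_var (i : 'I_n.+1) : {poly B} :=
  if unlift ord_max i is Some j then ('X_j)%:P else 'X.
Definition uni : A -> {poly B} := mmap (polyC \o @mpolyC n R) uni_var.
HB.instance Definition _ := GRing.RMorphism.on uni.

Definition wid : B -> A := mmap (@mpolyC n.+1 R) (fun j => 'X_(lift ord_max j)).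
HB.instance Definition _ := GRing.RMorphism.on wid.

Definition multi (q : {poly B}) : A := (map_poly wid q).['X_ord_max].

Lemma uniC c : uni c%:MP = (c%:MP)%:P. Proof. exact: mmapC. Qed.
Lemma uniX i : uni 'X_i = uni_var i.
Proof. by rewrite /uni mmapX mmap1U. Qed.
Lemma uniM : {morph uni : p q / p * q}. Proof. exact: rmorphM. Qed.
Lemma uniD : {morph uni : p q / p + q}. Proof. exact: mmapD. Qed.
Lemma widC c : wid c%:MP = c%:MP. Proof. exact: mmapC. Qed.
Lemma widX j : wid 'X_j = 'X_(lift ord_max j).
Proof. by rewrite /wid mmapX mmap1U. Qed.
Lemma widM : {morph wid : p q / p * q}. Proof. exact: rmorphM. Qed.
Lemma widD : {morph wid : p q / p + q}. Proof. exact: mmapD. Qed.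
Lemma multiM : {morph multi : p q / p * q}.
Proof. by move=> p q; rewrite /multi rmorphM hornerM. Qed.
Lemma multiD : {morph multi : p q / p + q}.
Proof. by move=> p q; rewrite /multi rmorphD hornerD. Qed.
Lemma multiC c : multi c%:P = wid c.
Proof. by rewrite /multi map_polyC hornerC. Qed.
Lemma multiX : multi 'X = 'X_ord_max.
Proof. by rewrite /multi map_polyX hornerX. Qed.

Lemma uniK : cancel uni multi.
Proof.
elim/mpoly_ind_mulX => [c|p q IHp IHq|i p IHp].
- by rewrite uniC multiC widC.
- by rewrite uniD; move: (uni p) (uni q) IHp IHq => a b <- <-; exact: multiD.
- rewrite uniM; move: (uni p) IHp => a <-; rewrite multiM uniX /uni_var.
  by case: unliftP => [j ->|->]; rewrite ?multiC ?widX ?multiX.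
Qed.

Lemma uni_wid p : uni (wid p) = p%:P.
Proof.
elim/mpoly_ind_mulX: p => [c|p q IHp IHq|i p IHp].
- by rewrite widC uniC.
- rewrite widD uniD polyCD; exact: (congr2 +%R IHp IHq).
- rewrite widM uniM widX uniX /uni_var liftK polyCM; exact: (congr1 _ IHp).
Qed.

Lemma multiK : cancel multi uni.
Proof.
elim/poly_ind => [|p c IHp]; first by rewrite -polyC0 multiC uni_wid.
rewrite multiD multiM uniD uniM multiX multiC uni_wid uniX /uni_var unlift_none.
by move: (uni (multi p)) IHp => a ->.
Qed.

Lemma uni_meval (v : 'I_n.+1 -> R) p :
  p.@[v] = (map_poly (meval (fun j => v (lift ord_max j))) (uni p)).[v ord_max].
Proof.
elim/mpoly_ind_mulX: p => [c|p q IHp IHq|i p IHp].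
- by rewrite uniC map_polyC hornerC /= !mevalC.
- by rewrite uniD mevalD IHp IHq; move: (uni p) (uni q) => a b; rewrite rmorphD hornerD.
- rewrite uniM mevalM IHp; move: (uni p) => a; rewrite rmorphM hornerM; congr (_ * _).
  rewrite mevalXU uniX /uni_var.
  case: unliftP => [j ->|->]; last by rewrite /= map_polyX hornerX.
  by rewrite /= map_polyC hornerC /= mevalXU.
Qed.

End MpolyPoly.

Lemma mpoly_nullstellensatz (k : closedFieldType) (n : nat) :
  @affine_nullstellensatz k {mpoly k[n]} _ (fun v => meval v).
Proof.
elim: n => [|n IH].
  (* Without variables the ring is the field k, where every nonzero element is a unit and none is
     irreducible. *)
  have unit0 (p : {mpoly k[0]}) : p != 0 -> exists2 c, c != 0 & p = c%:MP.
    move=> p0; have pE : p = (p@_0%MM)%:MP.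
      apply/mpolyP => m; rewrite mcoeffC.
      have -> : m = 0%MM by apply/mnmP => -[].
      by rewrite eqxx mulr1.
    by exists p@_0%MM => //; apply: contraNneq p0 => E; rewrite pE E mpolyC0.
  have unitP (p : {mpoly k[0]}) : p != 0 -> p \is a GRing.unit.
    move=> /unit0 [c c0 ->]; apply/unitrP; exists (c^-1)%:MP.
    by rewrite -!mpolyCM mulVf // mulfV.
  split.
  - by move=> p /unitP; exact: factorial_unit.
  - move=> p /unit0 [c c0 ->]; exists (fun=> 0); by rewrite /= mevalC.
  - by move=> f g [/unitP ->].
have [U _ _] := IH.
split.
- exact: iso_ufd (@uniK k n) (@multiK k n) (ufd_poly U).
- move=> p p0; have up0 : uni p != 0 by rewrite (iso_neq0 (@uniK k n)).
  have [v [t vt]] := nonzero_poly_point IH up0.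
  (* This is the point v extended by the last coordinate t. *)
  exists (fun i => if unlift ord_max i is Some j then v j else t).
  rewrite /= uni_meval unlift_none.
  have -> // : map_poly (meval (fun j => if unlift ord_max (lift ord_max j) is Some j'
    then v j' else t)) (uni p) = map_poly (meval v) (uni p).
  by apply: eq_map_poly => q; apply: meval_eq => j; rewrite liftK.
- move=> f g firr van; apply: (iso_divides (@uniK k n) (@multiK k n)).
  apply: (null_poly IH); first exact: iso_irreducible (@uniK k n) (@multiK k n) _ firr.
  move=> v t.
  pose w i := if unlift ord_max i is Some j then v j else t.
  have E p : (map_poly (meval v) (uni p)).[t] = p.@[w].
    rewrite uni_meval /w unlift_none; congr (_.[t]).
    by apply: eq_map_poly => q; apply: meval_eq => j; rewrite liftK.
  move=> fwt; apply: (etrans (E g)); apply: van.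
  exact: (etrans (esym (E f)) fwt).
Qed.

(** * The resolution of the curve *)

Section Degrees.
Context (k : fieldType).
Local Notation S := {mpoly k[6]}.

(** The entry in row i and column j maps S(e'_j) to S(e_i), so its degree has to be e_i - e'_j. *)
Lemma mulmx_graded p q (M : 'M[S]_(p, q)) (e : 'cV[int]_p) (e' : 'cV[int]_q) :
    (forall i j, mpoly_piece (e i 0 - e' j 0) (M i j)) ->
  @graded_hom k 6 (freeGrMod k 6 e') (freeGrMod k 6 e) (mulmx M).
Proof.
move=> hM; split=> [a u v|d v hv i] /=; first by rewrite mulmxDr scalemxAr.
rewrite mxE; elim/big_ind: _ => [|x y hx hy|j _]; first exact: mpoly_piece0.
  rewrite -[y]opprK; apply: mpoly_pieceB => //.
  by rewrite -sub0r; apply: mpoly_pieceB => //; exact: mpoly_piece0.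
have -> : e i 0 + d = (e i 0 - e' j 0) + (e' j 0 + d) by rewrite addrA subrK.
exact: mpoly_pieceM.
Qed.

Lemma mx_of_rows_homog d p q (rows : seq (seq S)) i j :
  all (all (fun x => x \is d.-homog)) rows -> mx_of_rows p q rows i j \is d.-homog.
Proof.
move=> /allP h; rewrite mxE; have [lt_i|le_i] := ltnP i (size rows); last first.
  by rewrite (nth_default _ le_i) nth_nil; exact: dhomog0.
have [lt_j|le_j] := ltnP j (size (nth [::] rows i)); last first.
  by rewrite (nth_default _ le_j); exact: dhomog0.
by have /h/allP := mem_nth [::] lt_i; apply; exact: mem_nth.
Qed.

Let hX i : ('X_i : S) \is 1.-homog. Proof. by rewrite dhomogX /= mdeg1. Qed.

Lemma M1_homog j : M1 k 0 j \is 2.-homog.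
Proof.
have hXX i i' : ('X_i * 'X_i' : S) \is 2.-homog by exact: dhomogM (hX i) (hX i').
by move: j; apply: ord6_ind; rewrite mxE /=; apply: rpredB; exact: hXX.
Qed.

Lemma M2_homog i j : M2 k i j \is 1.-homog.
Proof. by apply: mx_of_rows_homog; rewrite /= !rpredN !rpred0 !hX. Qed.

Lemma M3_homog i j : M3 k i j \is 1.-homog.
Proof. by apply: mx_of_rows_homog; rewrite /= !rpredN !rpred0 !hX. Qed.

Lemma mpoly_piece_eq d (e : int) (p : S) :
  p \is d.-homog -> e = Posz d -> mpoly_piece e p.
Proof. by move=> h ->. Qed.

Lemma scalar_mx_homog n d (F : S) (i j : 'I_n) :
  F \is d.-homog -> (F%:M : 'M_n) i j \is d.-homog.
Proof. by move=> hF; rewrite mxE; case: eqP => _; rewrite ?rpred0. Qed.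

End Degrees.

(** * The ideal of the curve *)

Section CurveIdeal.
Context (k : closedFieldType) (m : nat) (f : {mpoly k[3]}).
Hypotheses (hm : (1 <= m)%N) (hf : f \is (2 * m).-homog) (hirr : irreducible_elt f).
Local Notation S := {mpoly k[6]}.
Local Notation phi := (@vmap k).
Local Notation F := (lifted_eq m f).

Lemma curve_nullstellensatz g :
  (forall a, plane_curve f a -> g.@[a] = 0) -> divides f g.
Proof.
move=> van; have [U _ nul] := mpoly_nullstellensatz k 3.
have [f0 _ fP] := ufd_irreducible_prime U hirr.
(* The factor x_0 takes care of the origin, which plane_curve excludes. *)
have /fP [//|[c E]] : divides f (g * 'X_(@Ordinal 3 0 isT)).
  apply: nul hirr _ => a /= fa; rewrite mevalM mevalXU.
  have [a0|a0] := eqVneq (a (@Ordinal 3 0 isT)) 0; first by rewrite a0 mulr0.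
  by rewrite van ?mul0r //; split; first by exists (@Ordinal 3 0 isT).
(* In the remaining case f divides x_0, which is impossible because f has degree 2m, at least 2. *)
have c0 : c != 0.
  apply/eqP => c0; have := msizeX k U_(@Ordinal 3 0 isT)%MM.
  by rewrite E c0 mulr0 msize0.
have sf : (2 * m < msize f)%N.
  have f_lead := mlead_supp f0.
  by have := msize_mdeg_lt f_lead; rewrite (dhomog_mf hf f_lead).
exfalso; have := msizeX k U_(@Ordinal 3 0 isT)%MM.
rewrite E msizeM // mdeg1.
have : (0 < msize c)%N by rewrite lt0n msize_poly_eq0.
by move: sf hm; clear; move: (msize f) (msize c) => a b; lia.
Qed.

Lemma has_parity_f : has_parity odd_mdeg false f.
Proof.
by move=> n /(dhomog_mf hf) /= E; rewrite /odd_mdeg E mul2n odd_double.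
Qed.

Definition cone_combination (w : 'cV[S]_6) (G : S) : S := (M1 k *m w) 0 0 + F * G.

Lemma homog_vanishing_combination h :
    homog_vanishing (veronese_image (plane_curve f)) h ->
  exists w G, h = cone_combination w G.
Proof.
move=> [_ van]; have [c Ec] : divides f (phi h).
  apply: curve_nullstellensatz => a Ca; rewrite vmap_meval; apply: van.
  by exists a => //; exists 1; [exact: oner_neq0 | move=> i; rewrite mul1r].
(* The cofactor c is replaced by its even part, which is the image of some G. *)
have [G EG] := vmap_div has_parity_f Ec.
have [w Ew] : exists w : 'cV_6, h - F * G = (M1 k *m w) 0 0.
  by apply: ker_vmap; rewrite vmapD vmapN vmapM (vmap_lifted_eq hf) EG subrr.
by exists w, G; rewrite /cone_combination -Ew subrK.
Qed.

Lemma curve_ideal_combination h :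
    ideal_gen (homog_vanishing (veronese_image (plane_curve f))) h ->
  exists w G, h = cone_combination w G.
Proof.
move=> [r [a [g [hg ->]]]]; elim/big_ind: _ => [|p q [w [G ->]] [w' [G' ->]]|i _].
- by exists 0, 0; rewrite /cone_combination mulmx0 mxE mulr0 addr0.
- exists (w + w'), (G + G').
  by rewrite /cone_combination mulmxDr [in RHS]mxE mulrDr addrACA.
- have [w [G ->]] := homog_vanishing_combination (hg i).
  exists (a i *: w), (a i * G).
  by rewrite /cone_combination -scalemxAr [in RHS]mxE mulrDr mulrCA.
Qed.

Lemma homog_vanishing_phi d (h : S) : h \is d.-homog ->
    (forall a, plane_curve f a -> (phi h).@[a] = 0) ->
  homog_vanishing (veronese_image (plane_curve f)) h.
Proof.
move=> hh van; split; first exact: homogE hh.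
move=> b [a Ca [c _ Eb]].
by rewrite (dhomog_meval_scale hh Eb) -vmap_meval van // mulr0.
Qed.

(** The minors vanish on the whole Veronese surface, and F pulls back to f, which vanishes on C. *)
Lemma combination_in_curve_ideal w G :
  ideal_gen (homog_vanishing (veronese_image (plane_curve f))) (cone_combination w G).
Proof.
have gen h a : homog_vanishing (veronese_image (plane_curve f)) h ->
    ideal_gen (homog_vanishing (veronese_image (plane_curve f))) (a * h).
  move=> hh; apply: ideal_genM.
  by exists 1%N, (fun=> 1), (fun=> h); split=> //; rewrite big_ord1 mul1r.
apply: ideal_genD.
  rewrite mxE; apply: ideal_gen_sum => j; rewrite mulrC; apply: gen.
  apply: (homog_vanishing_phi (M1_homog k j)) => a _.
  have -> : M1 k 0 j = (M1 k *m (delta_mx j 0 : 'cV_6)) 0 0.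
    by rewrite -colE [RHS]mxE.
  by rewrite vmap_M1 meval0.
rewrite mulrC; apply: gen; apply: homog_vanishing_phi (lifted_eq_homog m f) _.
by move=> a [_ fa]; rewrite (vmap_lifted_eq hf).
Qed.

End CurveIdeal.

(** * The mapping cone of multiplication by F *)

Section MappingCone.
Context (k : fieldType) (F : {mpoly k[6]}).
Local Notation S := {mpoly k[6]}.
Local Notation M1 := (M1 k).
Local Notation M2 := (M2 k).
Local Notation M3 := (M3 k).

Lemma M1'E (v : 'cV[S]_(6 + 1)) :
  M1' F *m v = M1 *m usubmx v + F *: dsubmx v.
Proof. by rewrite -[v in LHS]vsubmxK mul_row_col mul_scalar_mx. Qed.

Lemma M2'E (v : 'cV[S]_(8 + 6)) :
  M2' F *m v = col_mx (M2 *m usubmx v - F *: dsubmx v) (M1 *m dsubmx v).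
Proof.
by rewrite -[v in LHS]vsubmxK mul_block_col mulNmx mul_scalar_mx mul0mx add0r.
Qed.

Lemma M3'E (v : 'cV[S]_(3 + 8)) :
  M3' F *m v = col_mx (M3 *m usubmx v + F *: dsubmx v) (M2 *m dsubmx v).
Proof. by rewrite -[v in LHS]vsubmxK mul_block_col mul_scalar_mx mul0mx add0r. Qed.

Lemma M4'E (v : 'cV[S]_3) : M4' F *m v = col_mx (- (F *: v)) (M3 *m v).
Proof. by rewrite mul_col_mx mulNmx mul_scalar_mx. Qed.

Let M1M2v (w : 'cV[S]_8) : M1 *m (M2 *m w) = 0.
Proof. by rewrite mulmxA M1M2 mul0mx. Qed.
Let M2M3v (w : 'cV[S]_3) : M2 *m (M3 *m w) = 0.
Proof. by rewrite mulmxA M2M3 mul0mx. Qed.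

Lemma M4'_inj : injective (mulmx (M4' F) : 'cV[S]_3 -> _).
Proof.
move=> u v E; apply/eqP; rewrite -subr_eq0; apply/eqP/M3_inj.
move: E; rewrite !M4'E => /eq_col_mx [_ E].
by rewrite mulmxBr E subrr.
Qed.

(** The lower block of a cycle is M3 z for some z, and injectivity of [M3] forces the upper block to
    be -F z. *)
Lemma M3'_exact (y : 'cV[S]_(3 + 8)) :
  M3' F *m y = 0 <-> exists x : 'cV[S]_3, M4' F *m x = y.
Proof.
split=> [|[x <-]]; last first.
  rewrite M3'E M4'E col_mxKu col_mxKd M2M3v mulmxN -scalemxAr addNr.
  by rewrite col_mx0.
rewrite M3'E -col_mx0 => /eq_col_mx [E1 /M2_exact [z Ez]].
exists z; rewrite M4'E -[RHS]vsubmxK -Ez; congr col_mx.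
have /M3_inj /eqP : M3 *m (usubmx y + F *: z) = 0.
  by rewrite mulmxDr -scalemxAr -Ez.
by rewrite addr_eq0 => /eqP ->.
Qed.

(** Once the lower block is written as M2 z, subtracting F z from the upper block gives an element
    of the kernel of [M2]. *)
Lemma M2'_exact (y : 'cV[S]_(8 + 6)) :
  M2' F *m y = 0 <-> exists x : 'cV[S]_(3 + 8), M3' F *m x = y.
Proof.
split=> [|[x <-]]; last first.
  rewrite M2'E M3'E col_mxKu col_mxKd M1M2v mulmxDr M2M3v add0r -scalemxAr subrr.
  by rewrite col_mx0.
rewrite M2'E -col_mx0 => /eq_col_mx [E1 /M1_exact [z Ez]].
have /M2_exact [t Et] : M2 *m (usubmx y - F *: z) = 0.
  by rewrite mulmxBr -scalemxAr -Ez.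
exists (col_mx t z); rewrite M3'E col_mxKu col_mxKd -[RHS]vsubmxK -Ez.
by congr col_mx; rewrite -Et subrK.
Qed.

(** If d is the last entry of a cycle, then F d lies in the image of [M1], which [vmap] kills. As
    [vmap F] is nonzero, d is in the kernel of [vmap], hence itself in that image. *)
Lemma M1'_exact (y : 'cV[S]_(6 + 1)) : vmap F != 0 ->
  M1' F *m y = 0 <-> exists x : 'cV[S]_(8 + 6), M2' F *m x = y.
Proof.
move=> F0; split=> [|[x <-]]; last first.
  rewrite M1'E M2'E col_mxKu col_mxKd mulmxBr M1M2v sub0r -scalemxAr.
  by rewrite addNr.
rewrite M1'E => E1.
have E00 : (M1 *m usubmx y) 0 0 + F * dsubmx y 0 0 = 0.
  have := congr1 (fun A : 'cV_1 => A 0 0) E1; rewrite [RHS]mxE => <-.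
  by rewrite [RHS]mxE [X in _ = _ + X]mxE.
have /ker_vmap [z Ez] : vmap (dsubmx y 0 0) = 0.
  apply: (mulf_eq0l F0); rewrite -vmapM.
  by have := congr1 (@vmap k) E00; rewrite vmapD vmap_M1 add0r vmap0.
have Ez' : dsubmx y = M1 *m z by apply/colP => i; rewrite ord1.
have /M1_exact [t Et] : M1 *m (usubmx y + F *: z) = 0.
  by rewrite mulmxDr -scalemxAr -Ez'.
exists (col_mx t z); rewrite M2'E col_mxKu col_mxKd -[RHS]vsubmxK -Ez'.
by congr col_mx; rewrite -Et addrK.
Qed.

End MappingCone.

(** * Degrees of the maps in the resolution *)

Section GradedMaps.
Context (k : fieldType) (m : nat) (F : {mpoly k[6]}) (hF : F \is m.-homog).

Let hFN n (i j : 'I_n) : (- F%:M : 'M_n) i j \is m.-homog.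
Proof. by rewrite mxE rpredN; exact: scalar_mx_homog. Qed.

Local Ltac degree := rewrite ?(col_mxEu, col_mxEd) !mxE; ring.

Lemma M1'_graded : @graded_hom k 6 (freeGrMod k 6 (twist2 6 1 (- 2%:Z) (- m%:Z)))
  (freeGrMod k 6 (twist1 1 0)) (mulmx (M1' F)).
Proof.
apply: mulmx_graded => i j; rewrite ord1; case: (split_ordP j) => l ->.
- rewrite row_mxEl; apply: (mpoly_piece_eq (M1_homog _ _)); degree.
- rewrite row_mxEr; apply: (mpoly_piece_eq (scalar_mx_homog _ _ hF)); degree.
Qed.

Lemma M2'_graded : @graded_hom k 6 (freeGrMod k 6 (twist2 8 6 (- 3%:Z) (- m%:Z - 2)))
  (freeGrMod k 6 (twist2 6 1 (- 2%:Z) (- m%:Z))) (mulmx (M2' F)).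
Proof.
apply: mulmx_graded => i j; case: (split_ordP i) => r ->; case: (split_ordP j) => l ->.
- rewrite block_mxEul; apply: (mpoly_piece_eq (M2_homog _ _ _)); degree.
- rewrite block_mxEur; apply: (mpoly_piece_eq (hFN _ _)); degree.
- rewrite block_mxEdl [X in mpoly_piece _ X]mxE; exact: mpoly_piece0.
- rewrite block_mxEdr [r]ord1; apply: (mpoly_piece_eq (M1_homog _ _)); degree.
Qed.

Lemma M3'_graded : @graded_hom k 6 (freeGrMod k 6 (twist2 3 8 (- 4%:Z) (- m%:Z - 3)))
  (freeGrMod k 6 (twist2 8 6 (- 3%:Z) (- m%:Z - 2))) (mulmx (M3' F)).
Proof.
apply: mulmx_graded => i j; case: (split_ordP i) => r ->; case: (split_ordP j) => l ->.
- rewrite block_mxEul; apply: (mpoly_piece_eq (M3_homog _ _ _)); degree.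
- rewrite block_mxEur; apply: (mpoly_piece_eq (scalar_mx_homog _ _ hF)); degree.
- rewrite block_mxEdl [X in mpoly_piece _ X]mxE; exact: mpoly_piece0.
- rewrite block_mxEdr; apply: (mpoly_piece_eq (M2_homog _ _ _)); degree.
Qed.

Lemma M4'_graded : @graded_hom k 6 (freeGrMod k 6 (twist1 3 (- m%:Z - 4)))
  (freeGrMod k 6 (twist2 3 8 (- 4%:Z) (- m%:Z - 3))) (mulmx (M4' F)).
Proof.
apply: mulmx_graded => i j; case: (split_ordP i) => r ->.
- rewrite [M4' _ _ _]col_mxEu; apply: (mpoly_piece_eq (hFN _ _)); degree.
- rewrite [M4' _ _ _]col_mxEd; apply: (mpoly_piece_eq (M3_homog _ _ _)); degree.
Qed.

Lemma quot_graded (I : homogIdeal k 6) :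
  @graded_hom k 6 (freeGrMod k 6 (twist1 1 0)) (quotGrMod I)
    (fun v => quot_pi I (v 0 0)).
Proof.
split=> [a u v|d v hv] /=.
  by rewrite !mxE raddfD /=; congr (_ + _); rewrite -quot_scale_pi.
by exists (v 0 0) => //; have := hv 0; rewrite mxE add0r.
Qed.

End GradedMaps.

Theorem theorem4 (k : closedFieldType) (m : nat) (f : {mpoly k[3]})
    (hm : (1 <= m)%N) (hf : f \is (2 * m).-homog) (hirr : irreducible_elt f) :
  let I_C := proj_ideal (veronese_image (plane_curve f)) in
  let F := lifted_eq m f in
  let G0 := freeGrMod k 6 (twist1 1 0) in
  let G1 := freeGrMod k 6 (twist2 6 1 (- 2%:Z) (- m%:Z)) in
  let G2 := freeGrMod k 6 (twist2 8 6 (- 3%:Z) (- m%:Z - 2)) in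
  let G3 := freeGrMod k 6 (twist2 3 8 (- 4%:Z) (- m%:Z - 3)) in
  let G4 := freeGrMod k 6 (twist1 3 (- m%:Z - 4)) in
  let d0 : G0 -> quotGrMod I_C := fun v => quot_pi I_C (v 0 0) in
  let d1 : G1 -> G0 := mulmx (M1' F) in
  let d2 : G2 -> G1 := mulmx (M2' F) in
  let d3 : G3 -> G2 := mulmx (M3' F) in
  let d4 : G4 -> G3 := mulmx (M4' F) in
  [/\ graded_hom d4, graded_hom d3, graded_hom d2, graded_hom d1 &
      graded_hom d0] /\
  [/\ injective d4, exact_at d4 d3, exact_at d3 d2 &
   [/\ exact_at d2 d1, exact_at d1 d0 & forall y, exists x, d0 x = y]].
Proof.
move=> I_C F G0 G1 G2 G3 G4 d0 d1 d2 d3 d4.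
have hF : F \is m.-homog := lifted_eq_homog m f.
split; first by split; [exact: M4'_graded | exact: M3'_graded | exact: M2'_graded
  | exact: M1'_graded | exact: quot_graded].
have F0 : vmap F != 0 by rewrite vmap_lifted_eq //; case: hirr.
split; first exact: M4'_inj.
- by move=> y; exact: M3'_exact.
- by move=> y; exact: M2'_exact.
split.
- by move=> y; exact: M1'_exact.
(* Exactness at S: the kernel of the projection is I_C, and its elements are exactly the
   combinations M1 w + F G. *)
- have d0E y : d0 y = 0 <-> y 0 0 \in I_C.
    rewrite -[X in _ <-> X \in _]subr0 -quot_piE raddf0; exact: iff_refl.
  move=> y; split=> [/d0E /asboolP|[x <-]].
    move=> /(curve_ideal_combination hm hf hirr) [w [G E]].
    exists (col_mx w G%:M); apply/matrixP => i j; rewrite !ord1 E.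
    by rewrite /d1 M1'E col_mxKu col_mxKd [LHS]mxE [X in _ + X]mxE [X in _ * X]mxE.
  apply/d0E/asboolP; rewrite /d1 M1'E [X in ideal_gen _ X]mxE [X in _ + X]mxE.
  exact: combination_in_curve_ideal.
- by move=> y; have [p ->] := quot_pi_surj y; exists p%:M; rewrite /d0 mxE.
Qed.
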